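(* Let $d,e,s\in\mathbb{N}$, for $i=1,\dots,s$ let $p_i,q_i:\mathbb{Z}^d\to\mathbb{Z}^e$ be polynomials satisfying $p_i(0)=q_i(0)=0$, and let $A\subseteq\mathbb{Z}^e$ satisfy $d^*(A)>0$. Then, for every Følner sequence $F=(F_N)_{N\in\mathbb{N}}$ in $\mathbb{Z}^d$, there is a set $B\subseteq\mathbb{Z}^d$ such that $\overline{d}_F(B)>0$ and $$\bigcup_{i=1}^s\left(p_i(B)+q_i(B)\right)\subseteq A-A.$$
   Context: A map $p:\mathbb{Z}^d\to\mathbb{Z}^e$ is a polynomial if $p(x)=(p^{(1)}(x),\dots,p^{(e)}(x))$ with each $p^{(j)}\in\mathbb{Q}[x_1,\dots,x_d]$. A Følner sequence in a countable abelian group $G$ is a sequence $(F_N)_{N\in\mathbb{N}}$ of finite nonempty subsets of $G$ such that $\lim_{N\to\infty}\frac{|(g+F_N)\Delta F_N|}{|F_N|}=0$ for all $g\in G$. For $E\subseteq G$, $\overline{d}_F(E)=\limsup_{N\to\infty}\frac{|E\cap F_N|}{|F_N|}$, and $d^*(E)=\sup\{\overline{d}_F(E):F\text{ a Følner sequence in }G\}$. $p(B)=\{p(b):b\in B\}$, $C+D=\{c+d:c\in C,d\in D\}$, $A-A=\{a-a':a,a'\in A\}$. *)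

(* Defs.v *)
From HB Require Import structures.
From mathcomp Require Import all_boot all_order all_algebra finmap.
From mathcomp Require Import all_classical all_reals all_analysis.
(* not imported: the notations of mpoly clash with those of analysis *)
From mathcomp Require mpoly.

Set Implicit Arguments.
Unset Strict Implicit.
Unset Printing Implicit Defensive.

Import Order.TTheory GRing.Theory Num.Theory.
Import numFieldNormedType.Exports.

Local Open Scope classical_set_scope.
Local Open Scope ring_scope.

Definition polynomial_map (d e : nat) (p : 'rV[int]_d -> 'rV[int]_e) : Prop :=
  exists P : 'I_e -> mpoly.mpoly d rat,
    forall (x : 'rV[int]_d) (j : 'I_e),
      (p x 0 j)%:~R = mpoly.meval (fun i : 'I_d => (x 0 i)%:~R) (P j) :> rat.

Definition translate (G : countZmodType) (g : G) (A : {fset G}) : {fset G} :=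
  [fset (g + x)%R | x in A]%fset.

Definition symdiff (G : countZmodType) (A B : {fset G}) : {fset G} :=
  ((A `\` B) `|` (B `\` A))%fset.

Definition folner (R : realType) (G : countZmodType) (F : nat -> {fset G}) :
    Prop :=
  (forall N, F N != fset0) /\
  forall g : G,
    (fun N => #|` symdiff (translate g (F N)) (F N)|%:R / #|` F N|%:R : R)
      @ \oo --> (0 : R).

Definition upper_density (R : realType) (G : countZmodType)
    (F : nat -> {fset G}) (E : set G) : \bar R :=
  limn_esup (fun N =>
    (#|` [fset x in F N | x \in E]%fset|%:R / #|` F N|%:R : R)%:E).

Definition upper_banach_density (R : realType) (G : countZmodType)
    (E : set G) : \bar R :=
  ereal_sup [set upper_density R F E | F in @folner R G].

Definition sumset (G : zmodType) (C D : set G) : set G :=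
  [set c + d | c in C & d in D].

Definition diffset (G : zmodType) (C D : set G) : set G :=
  [set c - d | c in C & d in D].

(* Main.v *)
Require Import Defs.
From HB Require Import structures.
From mathcomp Require Import all_boot all_order all_algebra finmap.
From mathcomp Require Import all_classical all_reals all_analysis.
From mathcomp Require Import ring lra.
From mathcomp Require mpoly.
Import (canonicals) mpoly.
Import Order.TTheory GRing.Theory Num.Theory.
Import numFieldNormedType.Exports.
Local Open Scope classical_set_scope.
Local Open Scope ring_scope.

Set Implicit Arguments.
Unset Strict Implicit.
Unset Printing Implicit Defensive.

(** The theorem follows from recurrence along one polynomial, because only
    differences are asked for.  If all of [a + p b], [a - q b] with [b] in [B]
    lie in [A], then
    [p b + q b' = (a + p b) - (a - q b')] lies in [A - A].  So it suffices to
    find a point [a] for which the set of [b] with both [a + p b] and [a - q b]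
    in [A] has positive upper density.  The [s] pairs are treated at once by
    working with matrices whose [s] rows are the coordinates: the power [A^s] has
    positive density again.

    Averaging over [a] with an invariant mean [m], an ultrafilter limit of Følner
    averages, turns the two conditions into the correlation of the indicator
    function of [A] with its translate by [r b = p b + q b].  The bounded
    functions with the form [m (f g)] are a pre-Hilbert space on which the group
    acts isometrically, so what is needed is a lower bound for averages of
    [ip (act (r n) f) f] that is uniform in the base point.  This is polynomial
    recurrence, [polynomial_recurrence].  Completeness, projections and spectral
    measures are avoided by working with nearly shortest points of convex hulls
    of orbits ([almost_periodic_part]).  For the monomial of top degree, with
    coefficient [c], one writes [f = g + h], where [h] is almost fixed by the
    multiples of [k c] and [g] has small averages along the multiples of every
    [a c].  By van der Corput's inequality the averages of [g] along the
    polynomial are small ([polynomial_average_small]).  On [h] the monomial acts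
    almost trivially at multiples of [k], so it can be dropped, and one continues
    with the remaining monomials ([polynomial_mean_ergodic]).  In the limit there
    remains a vector [h] with [ip h f >= ip h h - eps], and [ip h h] is bounded
    below by the square of the density of [A].

    Hence for all large [N] the mean over [a] of the density in [F N] of the good
    [b] is bounded below.  The good points [a] depend on [N]; a Fatou-type
    argument for finitely additive means, [infinitely_recurrent_points], gives
    points [a n] each of which serves one [N] in each of [n] prescribed windows,
    and [B] is the set of the [b] that are good for [a n] along an ultrafilter. *)

(** * Averages over finite lists *)

Definition avg (R : realType) (V : lmodType R) (X : Type) (l : seq X)
  (u : X -> V) : V := (size l)%:R^-1 *: \sum_(x <- l) u x.

Section Averages.
Context {R : realType}.

Lemma eq_avg (V : lmodType R) (X : Type) (l : seq X) (u v : X -> V) :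
  (forall x, u x = v x) -> avg l u = avg l v.
Proof. by move=> uv; rewrite /avg; congr (_ *: _); apply: eq_bigr => x _. Qed.

Lemma avg_morph (V W : lmodType R) (f : V -> W) (X : Type) (l : seq X)
    (u : X -> V) :
    (forall a v w, f (a *: v + w) = a *: f v + f w) ->
  f (avg l u) = avg l (fun x => f (u x)).
Proof.
move=> fL.
have f0 : f 0 = 0.
  have := fL 1 0 0; rewrite !scale1r !addr0 => /(congr1 (fun w => w - f 0)).
  by rewrite subrr addrK.
have fD v w : f (v + w) = f v + f w by rewrite -[v]scale1r fL !scale1r.
have fZ a v : f (a *: v) = a *: f v by rewrite -[a *: v]addr0 fL f0 addr0.
rewrite /avg fZ; congr (_ *: _).
by elim: l => [|x l IH]; rewrite ?big_nil // !big_cons fD IH.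
Qed.

Lemma avgB (V : lmodType R) (X : Type) (l : seq X) (u v : X -> V) :
  avg l (fun x => u x - v x) = avg l u - avg l v.
Proof. by rewrite /avg -scalerBr sumrB. Qed.

Lemma avg_cst (V : lmodType R) (X : Type) (l : seq X) (v : V) :
  (0 < size l)%N -> avg l (fun=> v) = v.
Proof.
move=> l0; rewrite /avg big_const_seq count_predT iter_addr_0 -[v *+ _]scaler_nat.
by rewrite scalerA mulVf ?scale1r // pnatr_eq0 -lt0n.
Qed.

Lemma avg_map (V : lmodType R) (X Y : Type) (h : X -> Y) (l : seq X)
    (u : Y -> V) :
  avg (map h l) u = avg l (fun x => u (h x)).
Proof. by rewrite /avg size_map big_map. Qed.

Lemma avg_allpairs (V : lmodType R) (X Y Z : Type) (h : X -> Y -> Z)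
    (l : seq X) (l' : seq Y) (u : Z -> V) :
  avg [seq h x y | x <- l, y <- l'] u
  = avg l (fun x => avg l' (fun y => u (h x y))).
Proof.
rewrite /avg size_allpairs natrM invfM -scalerA; congr (_ *: _).
by rewrite big_allpairs_dep /= scaler_sumr.
Qed.

Lemma avg_exchange (V : lmodType R) (X Y : Type) (l : seq X) (l' : seq Y)
    (u : X -> Y -> V) :
  avg l (fun x => avg l' (u x)) = avg l' (fun y => avg l (u^~ y)).
Proof.
rewrite /avg -(scaler_sumr (size l')%:R^-1) -(scaler_sumr (size l)%:R^-1).
rewrite !scalerA mulrC; congr (_ *: _).
exact: exchange_big.
Qed.

Lemma avg_cat (V : lmodType R) (X : Type) (l l' : seq X) (u : X -> V) :
  size l = size l' -> avg (l ++ l') u = 2^-1 *: (avg l u + avg l' u).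
Proof.
move=> ll'; rewrite /avg big_cat size_cat /= -ll' -scalerDr scalerA.
by rewrite -invfM -natrM mul2n addnn.
Qed.

Lemma ler_avg (X : eqType) (l : seq X) (u v : X -> R) :
  {in l, forall x, u x <= v x} -> avg (V := R^o) l u <= avg (V := R^o) l v.
Proof.
move=> uv; rewrite /avg; apply: ler_wpM2l; first by rewrite invr_ge0.
by rewrite !big_seq; apply: ler_sum => x /uv.
Qed.

Lemma ler_avgT (X : Type) (l : seq X) (u v : X -> R) :
  (forall x, u x <= v x) -> avg (V := R^o) l u <= avg (V := R^o) l v.
Proof.
move=> uv; rewrite /avg; apply: ler_wpM2l; first by rewrite invr_ge0.
by apply: ler_sum => x _.
Qed.

Lemma avg_norm_le (X : Type) (l : seq X) (u : X -> R) (b : R) :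
  0 <= b -> (forall x, `|u x| <= b) -> `|avg (V := R^o) l u| <= b.
Proof.
move=> b0 ub; rewrite /avg.
have [->|l0] := posnP (size l); first by rewrite invr0 scale0r normr0.
rewrite normrZ ger0_norm ?invr_ge0 // mulrC ler_pdivrMr ?ltr0n //.
apply: (le_trans (ler_norm_sum _ _ _)); rewrite mulr_natr.
apply: (le_trans (ler_sum _ (fun x _ => ub x))).
by rewrite big_const_seq count_predT iter_addr_0.
Qed.

Lemma size_allpairs_gt0 (X Y Z : Type) (h : X -> Y -> Z) (l : seq X)
    (l' : seq Y) :
  (0 < size l)%N -> (0 < size l')%N ->
  (0 < size [seq h x y | x <- l, y <- l'])%N.
Proof. by move=> l0 l'0; rewrite size_allpairs muln_gt0 l0. Qed.

End Averages.

(** * Isometric actions on pre-Hilbert spaces *)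

Record isometric_action (R : realType) (G : zmodType) (V : lmodType R) :=
  IsometricAction {
    ip : V -> V -> R;
    ipC : forall u v, ip u v = ip v u;
    ip_lin : forall w a u v, ip (a *: u + v) w = a * ip u w + ip v w;
    ip_ge0 : forall u, 0 <= ip u u;
    act : G -> V -> V;
    act_lin : forall x a u v, act x (a *: u + v) = a *: act x u + act x v;
    act0 : forall u, act 0 u = u;
    actD : forall x y u, act (x + y) u = act x (act y u);
    ip_act : forall x u v, ip (act x u) (act x v) = ip u v }.

Section PreHilbert.
Context {R : realType} {G : zmodType} {V : lmodType R}.
Variable E : isometric_action G V.
Implicit Types u v w : V.

Local Notation ip := (ip E).
Local Notation act := (act E).

Definition nrm u : R := Num.sqrt (ip u u).

Lemma ip0l w : ip 0 w = 0.
Proof.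
have := ip_lin E w 1 0 0; rewrite scale1r addr0 mul1r.
by move=> /(congr1 (fun a => a - ip 0 w)); rewrite subrr addrK.
Qed.
Lemma ipDl u v w : ip (u + v) w = ip u w + ip v w.
Proof. by have := ip_lin E w 1 u v; rewrite scale1r mul1r. Qed.
Lemma ipZl a u w : ip (a *: u) w = a * ip u w.
Proof. by rewrite -[a *: u]addr0 ip_lin ip0l addr0. Qed.
Lemma ipBl u v w : ip (u - v) w = ip u w - ip v w.
Proof. by rewrite ipDl -scaleN1r ipZl mulN1r. Qed.
Lemma ipDr u v w : ip w (u + v) = ip w u + ip w v.
Proof. by rewrite ipC ipDl !(ipC _ w). Qed.
Lemma ipZr a u w : ip w (a *: u) = a * ip w u.
Proof. by rewrite ipC ipZl !(ipC _ w). Qed.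
Lemma ipBr u v w : ip w (u - v) = ip w u - ip w v.
Proof. by rewrite ipC ipBl !(ipC _ w). Qed.

Lemma ip_avgl (X : Type) (l : seq X) (u : X -> V) w :
  ip (avg l u) w = avg (V := R^o) l (fun x => ip (u x) w).
Proof.
by apply: (@avg_morph R V R^o (fun v => ip v w)) => a v v'; rewrite ip_lin.
Qed.
Lemma ip_avgr (X : Type) (l : seq X) (u : X -> V) w :
  ip w (avg l u) = avg (V := R^o) l (fun x => ip w (u x)).
Proof. by rewrite ipC ip_avgl; apply: eq_avg => x; rewrite ipC. Qed.

Lemma act_avg (x : G) (X : Type) (l : seq X) (u : X -> V) :
  act x (avg l u) = avg l (fun t => act x (u t)).
Proof. by apply: avg_morph => a v w; rewrite act_lin. Qed.
Lemma actBv (x : G) u v : act x (u - v) = act x u - act x v.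
Proof. by rewrite addrC -scaleN1r act_lin scaleN1r addrC. Qed.
Lemma actC (x y : G) u : act x (act y u) = act y (act x u).
Proof. by rewrite -!actD addrC. Qed.

Lemma nrm_ge0 u : 0 <= nrm u. Proof. exact: sqrtr_ge0. Qed.
Lemma sqr_nrm u : nrm u ^+ 2 = ip u u.
Proof. by rewrite sqr_sqrtr // ip_ge0. Qed.
Lemma nrm_act (x : G) u : nrm (act x u) = nrm u.
Proof. by rewrite /nrm ip_act. Qed.
Lemma nrmN u : nrm (- u) = nrm u.
Proof. by rewrite /nrm -scaleN1r ipZl ipZr mulrA mulN1r opprK mul1r. Qed.
Lemma nrm_leP u b : 0 <= b -> (nrm u <= b) = (ip u u <= b ^+ 2).
Proof.
move=> b0; rewrite -sqr_nrm ler_sqr // nnegrE //; exact: nrm_ge0.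
Qed.

Lemma ip_le_nrm u v : ip u v <= nrm u * nrm v.
Proof.
have quad t : 0 <= ip u u + 2 * t * ip u v + t ^+ 2 * ip v v.
  have := ip_ge0 E (u + t *: v).
  rewrite !ipDl !ipDr !ipZl !ipZr (ipC E v u); lra.
have [v0|v0] := eqVneq (ip v v) 0.
  have [uv|uv] := leP (ip u v) 0.
    by apply: (le_trans uv); rewrite mulr_ge0 ?nrm_ge0.
  have := quad (- (ip u u + 1) / (2 * ip u v)).
  rewrite v0 mulr0 addr0.
  have -> : 2 * (- (ip u u + 1) / (2 * ip u v)) * ip u v = - (ip u u + 1).
    by field; rewrite gt_eqF.
  lra.
have c0 : 0 < ip v v by rewrite lt_def v0 ip_ge0.
have := quad (- ip u v / ip v v).
have -> : ip u u + 2 * (- ip u v / ip v v) * ip u v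
    + (- ip u v / ip v v) ^+ 2 * ip v v = ip u u - ip u v ^+ 2 / ip v v.
  by field; rewrite gt_eqF.
rewrite subr_ge0 ler_pdivrMr // => le2.
apply: (le_trans (ler_norm _)); rewrite -sqrtr_sqr -sqrtrM ?ip_ge0 //.
exact: ler_wsqrtr.
Qed.

Lemma norm_ip_le u v : `|ip u v| <= nrm u * nrm v.
Proof.
rewrite ler_norml ip_le_nrm andbT -lerNl.
by have := ip_le_nrm (- u) v; rewrite nrmN -scaleN1r ipZl mulN1r.
Qed.

Lemma nrmD u v : nrm (u + v) <= nrm u + nrm v.
Proof.
rewrite nrm_leP ?addr_ge0 ?nrm_ge0 // sqrrD !sqr_nrm !(ipDl, ipDr).
have := ip_le_nrm u v; rewrite (ipC E v u); lra.
Qed.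

Lemma nrmB u v : nrm (u - v) <= nrm u + nrm v.
Proof. by rewrite -(nrmN v) nrmD. Qed.

(** Expand [ip m m] with [m] the average once, and bound [ip (u x) m] by half
    of [ip (u x) (u x) + ip m m]. *)
Lemma ip_avg_le (X : Type) (l : seq X) (u : X -> V) :
  ip (avg l u) (avg l u) <= avg (V := R^o) l (fun x => ip (u x) (u x)).
Proof.
have [l0|l0] := posnP (size l).
  by rewrite /avg l0 invr0 !scale0r ip0l.
set m := avg l u.
have : ip m m <= avg (V := R^o) l (fun x => (ip (u x) (u x) + ip m m) / 2).
  rewrite {1}/m [leLHS]ip_avgl; apply: ler_avgT => x.
  have := ip_ge0 E (u x - m); rewrite !(ipBl, ipBr) (ipC E m (u x)); lra.
have -> : avg (V := R^o) l (fun x => (ip (u x) (u x) + ip m m) / 2)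
  = (avg (V := R^o) l (fun x => ip (u x) (u x)) + ip m m) / 2.
  rewrite -[X in _ + X](@avg_cst R R^o X l (ip m m)) //.
  rewrite /avg -scalerDr -big_split /= -mulr_suml /GRing.scale /=.
  by rewrite mulrA.
lra.
Qed.

Lemma nrm_avgT (X : Type) (l : seq X) (u : X -> V) b :
  0 <= b -> (forall x, nrm (u x) <= b) -> nrm (avg l u) <= b.
Proof.
move=> b0 ub; rewrite nrm_leP //; apply: (le_trans (ip_avg_le _ _)).
have [l0|l0] := posnP (size l).
  by rewrite /avg l0 invr0 !scale0r exprn_ge0.
rewrite -[leRHS](@avg_cst R R^o X l) //; apply: ler_avgT => x.
by rewrite -nrm_leP.
Qed.

End PreHilbert.
(** * Splitting off the almost periodic part in one direction *)

Section Splitting.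
Context {R : realType} {G : zmodType} {V : lmodType R}.
Variable E : isometric_action G V.
Local Notation ip := (ip E).
Local Notation act := (act E).
Local Notation nrm := (nrm E).

Section OneDirection.
Variables (f : V) (c : G).

(** The points of the convex hull of the translates of [f] by the multiples of
    [k c] are the averages [hull k l]. *)
Definition hull (k : nat) (l : seq int) : V :=
  avg l (fun j => act (c *~ (k%:Z * j)) f).

Definition hull_inf (k : nat) : R :=
  inf [set ip (hull k l) (hull k l) | l in [set l | (0 < size l)%N]].

Lemma has_inf_hull k :
  has_inf [set ip (hull k l) (hull k l) | l in [set l | (0 < size l)%N]].
Proof.
split; first by exists (ip (hull k [:: 0]) (hull k [:: 0])), [:: 0].
by exists 0 => _ [l _ <-]; exact: ip_ge0.
Qed.

Lemma hull_inf_le k l : (0 < size l)%N -> hull_inf k <= ip (hull k l) (hull k l).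
Proof. by move=> l0; apply: ge_inf; [case: (has_inf_hull k)|exists l]. Qed.

Lemma hull_inf_approx k e : 0 < e ->
  exists2 l, (0 < size l)%N & ip (hull k l) (hull k l) <= hull_inf k + e.
Proof.
by move=> /inf_adherent/(_ (has_inf_hull k))[_ [l l0 <-]] /ltW lt; exists l.
Qed.

(** Two nearly shortest points of a convex set are close to each other, by the
    parallelogram identity at their midpoint. *)
Lemma hull_dist_le k l l' : (0 < size l)%N -> (0 < size l')%N ->
  ip (hull k l - hull k l') (hull k l - hull k l')
  <= 2 * ip (hull k l) (hull k l) + 2 * ip (hull k l') (hull k l')
     - 4 * hull_inf k.
Proof.
move=> l0 l'0.
pose m := [seq x | x <- l, y <- l'] ++ [seq y | x <- l, y <- l'].
have mE : hull k m = 2^-1 *: (hull k l + hull k l').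
  rewrite /hull /m avg_cat ?size_allpairs // !avg_allpairs.
  congr (_ *: (_ + _)); first by apply: eq_avg => x; rewrite avg_cst.
  by rewrite avg_cst.
have m0 : (0 < size m)%N by rewrite size_cat addn_gt0 size_allpairs_gt0.
have := hull_inf_le k m0; rewrite mE ipZl ipZr.
rewrite !(ipBl, ipBr, ipDl, ipDr) (ipC E (hull k l') (hull k l)); lra.
Qed.

Lemma act_hull k j l :
  act (c *~ (k%:Z * j)) (hull k l) = hull k [seq j + x | x <- l].
Proof.
rewrite /hull act_avg avg_map; apply: eq_avg => x.
by rewrite -actD -mulrzDr mulrDr.
Qed.

Lemma hull_mul k a l : hull (k * a) l = hull k [seq a%:Z * x | x <- l].
Proof.
by rewrite /hull avg_map; apply: eq_avg => x; rewrite PoszM mulrA.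
Qed.

(** The squared distance [hull_inf k] from the origin to the hull is bounded in
    [k], so some [k] nearly maximises it.  A nearly shortest point [h] of that
    hull is almost fixed by the multiples of [k c], since its translates are
    nearly shortest too.  For every [a], the hull at [k a] is smaller but hardly
    farther from the origin, hence a nearly shortest point of it is still close
    to [h]: the averaging that produces it from [f] nearly kills [f - h]. *)
Lemma almost_periodic_part (eta : R) : 0 < eta -> nrm f <= 1 ->
  exists k l, [/\ (0 < k)%N, (0 < size l)%N,
    forall j, nrm (act (c *~ (k%:Z * j)) (hull k l) - hull k l) <= eta &
    forall a, (0 < a)%N -> exists2 l' : seq int, (0 < size l')%N &
      nrm (avg l' (fun j => act (c *~ (a%:Z * j)) (f - hull k l))) <= eta].
Proof.
(* The squared distances below are at most [4 e] and [6 e]; as [6 <= 3 ^ 2], the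
   distances add up to at most [2 + 3] times the square root of [e]. *)
move=> eta0 f1; pose e := (eta / 5) ^+ 2.
have e0 : 0 < e by rewrite exprn_gt0 // divr_gt0.
have [k k0 kmax] : exists2 k, (0 < k)%N &
    forall a, (0 < a)%N -> hull_inf (k * a) <= hull_inf k + e.
  pose S := [set hull_inf k | k in [set k | (0 < k)%N]].
  have hS : has_sup S.
    split; first by exists (hull_inf 1), 1%N.
    exists 1 => _ [k _ <-].
    apply: (le_trans (hull_inf_le k (isT : (0 < size [:: 0%Z])%N))).
    have -> : hull k [:: 0] = f.
      rewrite /hull /avg big_seq1 mulr0 mulr0z act0 /= invr1.
      by rewrite scale1r.
    by rewrite -(expr1n R 2) -nrm_leP.
  have [_ [k k0 <-] lt] := sup_adherent e0 hS.
  exists k => // a a0; rewrite -lerBlDr; apply: le_trans (ltW lt).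
  apply: lerB => //; apply: sup_ubound; first by case: hS.
  by exists (k * a)%N => //=; rewrite muln_gt0 k0.
have [l l0 lmin] := hull_inf_approx k e0.
set h := hull k l.
have inv j : nrm (act (c *~ (k%:Z * j)) h - h) <= 2 * (eta / 5).
  rewrite nrm_leP; last by rewrite mulr_ge0 // divr_ge0 // ltW.
  rewrite act_hull.
  apply: le_trans (hull_dist_le k _ _) _; rewrite ?size_map //.
  rewrite -act_hull ip_act exprMn -/e.
  by move: lmin; rewrite -/h; lra.
exists k, l; split => // [j|a a0].
  by apply: le_trans (inv j) _; lra.
have [l' l'0 l'min] := hull_inf_approx (k * a) e0.
exists [seq k%:Z * x | x <- l']; first by rewrite size_map.
rewrite avg_map.
have -> : avg l' (fun j => act (c *~ (a%:Z * (k%:Z * j))) (f - h)) =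
    (hull (k * a) l' - h)
    - avg l' (fun j => act (c *~ (k%:Z * (a%:Z * j))) h - h).
  rewrite avgB avg_cst // opprB addrA subrK -avgB.
  apply: eq_avg => j; rewrite actBv PoszM !mulrA.
  by rewrite (mulrC a%:Z).
apply: le_trans (nrmB _ _ _) _.
have -> : eta = 3 * (eta / 5) + 2 * (eta / 5) by field.
apply: lerD; last first.
  by apply: nrm_avgT => [|j]; [rewrite mulr_ge0 // divr_ge0 // ltW|exact: inv].
rewrite nrm_leP; last by rewrite mulr_ge0 // divr_ge0 // ltW.
move: l'min; rewrite hull_mul => l'min.
apply: le_trans (hull_dist_le k _ _) _; rewrite ?size_map //.
rewrite exprMn -/e.
by have := kmax a a0; move: lmin l'min e0; rewrite -/h; lra.
Qed.

End OneDirection.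
End Splitting.
(** * Iterated differences and van der Corput's inequality *)

Fixpoint diffs (D W : zmodType) (s : seq D) (r : D -> W) : D -> W :=
  if s is v :: s' then diffs s' (fun n => r (n + v) - r n) else r.

Section Differences.
Variables D W : zmodType.
Implicit Types (s : seq D) (r : D -> W).

Lemma diffs0 s n : diffs s (fun=> 0 : W) n = 0.
Proof.
elim: s => //= v s IH; rewrite (_ : (fun=> 0 - 0) = (fun=> 0 : W)) //.
by apply/funext => m; rewrite subrr.
Qed.

Lemma diffsD s r r' n :
  diffs s (fun n => r n + r' n) n = diffs s r n + diffs s r' n.
Proof.
elim: s r r' => //= v s IH r r'; rewrite -IH; congr (diffs s _ n).
by apply/funext => m; rewrite opprD addrACA.
Qed.

Lemma diffs_shift s r w n : diffs s (fun n => r (n + w)) n = diffs s r (n + w).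
Proof.
elim: s r => //= v s IH r; rewrite -IH; congr (diffs s _ n).
by apply/funext => m; rewrite -!addrA (addrC w).
Qed.

Lemma diffs_multiple s v r b : (forall n, diffs (v :: s) r n = b) ->
  forall h n, diffs s (fun n => r (n + v *+ h) - r n) n = b *+ h.
Proof.
move=> rb; elim=> [|h IH] n.
  rewrite [RHS]mulr0n -[RHS](diffs0 s n); congr (diffs s _ n).
  by apply/funext => m; rewrite mulr0n addr0 subrr.
rewrite [RHS]mulrSr -(IH n) -(rb (n + v *+ h)) /= -diffs_shift addrC -diffsD.
congr (diffs s _ n); apply/funext => m.
by rewrite mulrSr addrA addrA subrK.
Qed.

Lemma diff_const v r b : (forall n, r (n + v) - r n = b) ->
  forall n j, r (n + v *~ j) = r n + b *~ j.
Proof.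
move=> rb n; have rS m : r (m + v) = r m + b by rewrite -(rb m) subrKC.
have pos h m : r (m + v *+ h) = r m + b *+ h.
  elim: h => [|h IH]; first by rewrite !mulr0n !addr0.
  by rewrite !mulrSr !addrA rS IH.
case=> h; first exact: pos.
rewrite NegzE !mulrNz -!pmulrn.
by apply/eqP; rewrite -subr_eq opprK -pos subrK.
Qed.

End Differences.

Section VanDerCorput.
Context {R : realType} {D G : zmodType} {V : lmodType R}.
Variable E : isometric_action G V.
Local Notation ip := (ip E).
Local Notation act := (act E).
Local Notation nrm := (nrm E).

(** Van der Corput's argument, by induction on the number of directions.
    Average over [l] and over [0 <= j < H] in direction [k v].  The square of the
    inner average expands into correlations of the form
    [ip (act (r (n + h k v) - r n) g) g], and the exponent is a polynomial in [n]
    with one direction less, so the average over [l] makes them small, except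
    those with [h = 0], whose proportion is [1 / H].  The final list depends only
    on the leading coefficient [c *+ a] of [r]: the induction needs one list
    for all base points [z] and all exponents that arise by differencing. *)
Lemma polynomial_average_small (s : seq D) (v : D) (eps : R) : 0 < eps ->
  exists2 eta, 0 < eta & forall (g : V) (c : G), nrm g <= 2 ->
    (forall a, (0 < a)%N -> exists2 l : seq int, (0 < size l)%N &
      nrm (avg l (fun j => act (c *~ (a%:Z * j)) g)) <= eta) ->
    forall k a, (0 < k)%N -> (0 < a)%N ->
    exists2 l : seq D, (0 < size l)%N &
      forall r : D -> G, (forall n, diffs (v :: s) r n = c *+ a) ->
      forall z, nrm (avg l (fun t => act (r (z + t *+ k)) g)) <= eps.
Proof.
elim: s v eps => [|v' s IH] v eps eps0.
  exists eps => // g c _ erg k a k0 a0.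
  have [|l l0 small] := erg (a * k)%N; first by rewrite muln_gt0 a0.
  exists [seq v *~ j | j <- l]; first by rewrite size_map.
  move=> r rv z; rewrite avg_map.
  have -> : avg l (fun j => act (r (z + v *~ j *+ k)) g) =
            act (r z) (avg l (fun j => act (c *~ ((a * k)%N%:Z * j)) g)).
    rewrite act_avg; apply: eq_avg => j; rewrite -actD; congr (act _ g).
    rewrite pmulrn -mulrzA (diff_const rv); congr (_ + _).
    by rewrite pmulrn -mulrzA PoszM -mulrA (mulrC j).
  by rewrite nrm_act.
have e8 : 0 < eps ^+ 2 / 4 by rewrite divr_gt0 // exprn_gt0.
have [eta eta0 {}IH] := IH v' _ e8.
exists eta => // g c g2 erg k a k0 a0.
have [H H0 Hbig] : exists2 H, (0 < H)%N & 4 / H%:R <= eps ^+ 2 / 2.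
  exists (Num.truncn (8 / eps ^+ 2)).+1 => //.
  have := ltW (truncnS_gt (8 / eps ^+ 2)).
  rewrite ler_pdivrMr ?exprn_gt0 // => le8.
  by rewrite ler_pdivrMr ?ltr0n //; lra.
pose good (l : seq D) h := forall r : D -> G,
  (forall n, diffs (v' :: s) r n = c *+ (a * (k * h))) ->
  forall z, nrm (avg l (fun t => act (r (z + t *+ k)) g)) <= eps ^+ 2 / 4.
(* A sum of lists is good as soon as one of the summands is. *)
have [l l0 lgood] : exists2 l, (0 < size l)%N &
    forall h, (0 < h < H)%N -> good l h.
  elim: (H) => [|h [l l0 lgood]]; first exists [:: 0] => //.
    by move=> h; rewrite ltn0 andbF.
  have [->|h0] := posnP h; first by exists [:: 0] => // -[|[]].
  have [l' l'0 l'good] : exists2 l', (0 < size l')%N & good l' h.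
    by apply: IH; rewrite ?muln_gt0 ?a0 ?k0.
  exists [seq t + t' | t <- l, t' <- l']; first exact: size_allpairs_gt0.
  move=> i /andP[i0]; rewrite ltnS leq_eqVlt => /predU1P[->|ih] r rv z.
    rewrite avg_allpairs; apply: nrm_avgT => [|t]; first exact: ltW.
    have := l'good r rv (z + t *+ k); congr (_ <= _); congr nrm.
    by apply: eq_avg => t'; rewrite mulrnDl addrA.
  rewrite avg_allpairs avg_exchange; apply: nrm_avgT => [|t]; first exact: ltW.
  have := lgood i _ r rv (z + t *+ k); rewrite i0 ih => /(_ isT).
  congr (_ <= _); congr nrm.
  by apply: eq_avg => t'; rewrite mulrnDl (addrC (_ *+ k)) addrA.
exists [seq t + v *+ j | t <- l, j <- iota 0 H].
  by rewrite size_allpairs_gt0 ?size_iota.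
move=> r rv z; rewrite avg_allpairs.
pose u t j := act (r (z + (t + v *+ j) *+ k)) g.
have corr j h : (0 < h)%N -> (j + h < H)%N ->
    avg (V := R^o) l (fun t => ip (u t (j + h)%N) (u t j)) <= eps ^+ 2 / 2.
  move=> h0 jhH.
  pose q n := r (n + v *+ (k * h)) - r n.
  have qv n : diffs (v' :: s) q n = c *+ (a * (k * h)).
    by rewrite (diffs_multiple rv) -mulrnA.
  have hH : (0 < h < H)%N by rewrite h0 (leq_ltn_trans _ jhH) ?leq_addl.
  have small := lgood h hH q qv (z + v *+ j *+ k).
  have -> : avg (V := R^o) l (fun t => ip (u t (j + h)%N) (u t j)) =
      ip (avg l (fun t => act (q (z + v *+ j *+ k + t *+ k)) g)) g.
    rewrite ip_avgl; apply: eq_avg => t.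
    rewrite -(ip_act E (- r (z + (t + v *+ j) *+ k))) /u -!actD addNr act0.
    congr (ip (act _ g) g); rewrite /q (addrC (- _)); congr (r _ - r _).
      rewrite (mulnC k) mulrnA mulrnDr !mulrnDl -!addrA; congr (_ + _).
      by rewrite addrCA.
    by rewrite mulrnDl addrAC addrA.
  apply: le_trans (ip_le_nrm _ _ _) _.
  have -> : eps ^+ 2 / 2 = (eps ^+ 2 / 4) * 2 by field.
  by apply: ler_pM => //; exact: nrm_ge0.
pose b (i j : nat) : R := (eps ^+ 2 / 2) + (if i == j then 4 else 0).
have ub i j : i \in iota 0 H -> j \in iota 0 H ->
    avg (V := R^o) l (fun t => ip (u t i) (u t j)) <= b i j.
  rewrite !mem_iota !add0n /b => iH jH; case: ltngtP => [ij|ji|->].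
  - rewrite addr0 -{1}(subnKC (ltnW ij)).
    under eq_avg do rewrite ipC.
    by apply: corr; rewrite ?subn_gt0 // subnKC // ltnW.
  - rewrite addr0 -{1}(subnKC (ltnW ji)).
    by apply: corr; rewrite ?subn_gt0 // subnKC // ltnW.
  rewrite -[leLHS]add0r; apply: lerD.
    by rewrite divr_ge0 // exprn_ge0 // ltW.
  rewrite -[4](@avg_cst R R^o D l) //; apply: ler_avgT => t.
  rewrite -sqr_nrm /u nrm_act (_ : 4 = 2 ^+ 2); last by rewrite -natrX.
  by rewrite ler_sqr // nnegrE ?nrm_ge0.
rewrite nrm_leP; last exact: ltW.
apply: le_trans (ip_avg_le _ _ _) _.
pose I := iota 0 H; have I0 : (0 < size I)%N by rewrite size_iota.
have -> : avg (V := R^o) l (fun t => ip (avg I (u t)) (avg I (u t))) =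
    avg (V := R^o) I (fun i => avg (V := R^o) I (fun j =>
      avg (V := R^o) l (fun t => ip (u t i) (u t j)))).
  transitivity (avg (V := R^o) l (fun t => avg (V := R^o) I (fun i =>
      avg (V := R^o) I (fun j => ip (u t i) (u t j))))).
    apply: eq_avg => t; rewrite ip_avgl; apply: eq_avg => i.
    by rewrite ip_avgr.
  rewrite avg_exchange; apply: eq_avg => i.
  by rewrite avg_exchange.
apply: (@le_trans _ _ (avg (V := R^o) I (fun i => avg (V := R^o) I (b i)))).
  by apply: ler_avg => i iI; apply: ler_avg => j jI; exact: ub.
apply: (@le_trans _ _ (avg (V := R^o) I (fun=> eps ^+ 2))); last first.
  by rewrite avg_cst.
apply: ler_avg => i iI.
rewrite /avg /b big_split /= scalerDr.
rewrite -/(avg (V := R^o) I (fun=> eps ^+ 2 / 2)) avg_cst //.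
rewrite (bigD1_seq i) ?iota_uniq //= eqxx big1 ?addr0; last first.
  by move=> j /negPf ij; rewrite eq_sym ij.
rewrite size_iota.
by move: Hbig; rewrite /GRing.scale /=; lra.
Qed.
End VanDerCorput.
(** * Polynomial recurrence for isometric actions *)

(** Polynomial maps that vanish at [0], presented with one monomial [c *~ m n]
    of top degree split off at a time: [v :: s] are the directions of [m], along
    which differencing leaves only a multiple of [c].  The divisibility of [m] at
    multiples of [k] is what lets the monomial act almost trivially on vectors
    that are almost fixed by the multiples of [k c]. *)
Inductive layered_polynomial (D G : zmodType) : (D -> G) -> Prop :=
| layered0 : layered_polynomial (fun=> 0)
| layeredS (m : D -> int) (c : G) (v : D) (s : seq D) (a : nat) (r : D -> G) :
    (0 < a)%N ->
    (forall n, diffs (v :: s) (fun n => c *~ m n + r n) n = c *+ a) ->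
    (forall k n, exists j, m (n *+ k) = k%:Z * j) ->
    layered_polynomial r -> layered_polynomial (fun n => c *~ m n + r n).

Section Recurrence.
Context {R : realType} {D G : zmodType} {V : lmodType R}.
Variable E : isometric_action G V.
Local Notation ip := (ip E).
Local Notation act := (act E).
Local Notation nrm := (nrm E).

(** Induction on the number of monomials.  Write [f = g + h1] with [h1] almost
    periodic in the direction [c] of the top monomial: the contribution of [g]
    averages out, and on [h1] the top monomial acts almost trivially at multiples
    of [k1], which leaves a shorter polynomial.  The list [lh] exhibits [h] as a point of the convex hull of the
    orbit of [f]; invariant vectors do not distinguish it from [f]. *)
Lemma polynomial_mean_ergodic (r : D -> G) : layered_polynomial r ->
  forall (f : V) (eps : R), nrm f <= 1 -> 0 < eps ->
  exists k (lh : seq G), let h := avg lh (fun x => act x f) in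
    [/\ (0 < k)%N, (0 < size lh)%N, ip h h - eps <= ip h f &
      forall l, (0 < l)%N -> exists2 nu : seq D, (0 < size nu)%N &
        forall z, nrm (avg nu (fun t => act (r ((z + t) *+ (k * l))) f) - h)
                  <= eps].
Proof.
elim=> [|m c v s a {}r a0 rv mk _ IH] f eps f1 eps0.
  exists 1%N, [:: 0]; set h := avg _ _.
  have -> : h = f by rewrite /h /avg big_seq1 act0 invr1 scale1r.
  split=> // [|l l0]; first by rewrite lerBlDr lerDl ltW.
  exists [:: 0] => // z.
  by rewrite /avg big_seq1 act0 invr1 scale1r subrr /nrm ip0l sqrtr0 ltW.
have e3 : 0 < eps / 3 by rewrite divr_gt0.
have [eta' eta'0 small] := polynomial_average_small E s v e3.
pose eta := Num.min eta' (eps / 3).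
have eta0 : 0 < eta by rewrite lt_min eta'0.
have [k1 [l1 [k10 l10 inv erg]]] := almost_periodic_part c eta0 f1.
set h1 := hull E f c k1 l1 in inv erg.
have h11 : nrm h1 <= 1 by apply: nrm_avgT => // j; rewrite nrm_act.
have [k2 [l2 [k20 l20]]] := IH h1 _ h11 e3.
set h := avg l2 _ => hf conv.
have hE : avg [seq x + c *~ (k1%:Z * j) | x <- l2, j <- l1] (fun x => act x f)
          = h.
  rewrite avg_allpairs /h; apply: eq_avg => x.
  by rewrite /h1 /hull act_avg; apply: eq_avg => j; rewrite actD.
exists (k1 * k2)%N, [seq x + c *~ (k1%:Z * j) | x <- l2, j <- l1].
rewrite hE; split; first by rewrite muln_gt0 k10.
- exact: size_allpairs_gt0.
- have invh j : nrm (act (c *~ (k1%:Z * j)) h - h) <= eta.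
    rewrite /h act_avg -avgB; apply: nrm_avgT => [|x]; first exact: ltW.
    by rewrite actC -actBv nrm_act.
  have : ip h h1 <= ip h f + eps / 3.
    rewrite /h1 /hull ip_avgr -[leRHS](@avg_cst R R^o _ l1) //.
    apply: ler_avgT => j.
    rewrite -(ip_act E (c *~ (k1%:Z * - j))) -actD -mulrzDr -mulrDr addNr.
    rewrite mulr0 mulr0z act0 -lerBlDl -ipBl.
    apply: le_trans (ip_le_nrm _ _ _) _; rewrite -[leRHS]mulr1.
    apply: ler_pM => //; rewrite ?nrm_ge0 //.
    by apply: le_trans (invh _) _; rewrite ge_min lexx orbT.
  by move: hf; lra.
move=> l l0; set K := (k1 * k2 * l)%N.
have K0 : (0 < K)%N by rewrite !muln_gt0 k10 k20.
have g2 : nrm (f - h1) <= 2.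
  by apply: le_trans (nrmB _ _ _) _; rewrite (_ : 2 = 1 + 1) // lerD.
have [|nu1 nu10 small1] := small (f - h1) c g2 _ K a K0 a0.
  move=> b b0; have [l' l'0 le'] := erg b b0; exists l' => //.
  by apply: le_trans le' _; rewrite ge_min lexx.
have [|nu2 nu20 conv2] := conv (k1 * l)%N; first by rewrite muln_gt0 k10.
have {}conv2 z : nrm (avg nu2 (fun t => act (r ((z + t) *+ K)) h1) - h)
    <= eps / 3.
  by have := conv2 z; rewrite mulnCA mulnA.
pose p n := c *~ m n + r n.
pose nu := [seq t + t' | t <- nu2, t' <- nu1].
have nu0 : (0 < size nu)%N by apply: size_allpairs_gt0.
exists nu => // z.
pose N t := (z + t) *+ K.
have -> : avg nu (fun t => act (p (N t)) f) - h =
    avg nu (fun t => act (p (N t)) (f - h1))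
    + (avg nu (fun t => act (p (N t)) h1 - act (r (N t)) h1)
       + (avg nu (fun t => act (r (N t)) h1) - h)).
  rewrite (@eq_avg R V _ nu (fun t => act (p (N t)) (f - h1))
    (fun t => act (p (N t)) f - act (p (N t)) h1)).
    by rewrite !avgB subrKA subrKA.
  by move=> t; rewrite actBv.
have -> : eps = eps / 3 + (eps / 3 + eps / 3) by field.
apply: le_trans (nrmD _ _ _) _; apply: lerD.
  rewrite /nu avg_allpairs; apply: nrm_avgT => [|t]; first exact: ltW.
  have := small1 _ rv ((z + t) *+ K); congr (_ <= _); congr nrm.
  by apply: eq_avg => t'; rewrite /p /N -mulrnDl addrA.
apply: le_trans (nrmD _ _ _) _; apply: lerD.
  apply: nrm_avgT => [|t]; first exact: ltW.
  rewrite /p (addrC (c *~ _)) actD -actBv nrm_act.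
  have [j ->] := mk K (z + t).
  rewrite /K -mulnA PoszM -mulrA.
  by apply: le_trans (inv _) _; rewrite ge_min lexx orbT.
rewrite /nu avg_allpairs avg_exchange -(@avg_cst R V _ nu1 h) // -avgB.
apply: nrm_avgT => [|t]; first exact: ltW.
have := conv2 (z + t); congr (_ <= _); congr (nrm (_ - h)).
by apply: eq_avg => t'; rewrite /N addrAC addrA.
Qed.

(** An invariant vector [e] keeps the limit point [h] away from [0], since all
    points of the convex hull of the orbit of [f] have the same inner product
    with [e]. *)
Lemma polynomial_recurrence (r : D -> G) (f e : V) :
  layered_polynomial r -> nrm f <= 1 -> nrm e <= 1 ->
  (forall x, act x e = e) -> 0 < ip f e ->
  exists k (l : seq D), [/\ (0 < k)%N, (0 < size l)%N & forall z,
    ip f e ^+ 2 / 2 <= avg (V := R^o) l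
                         (fun t => ip (act (r ((z + t) *+ k)) f) f)].
Proof.
move=> rP f1 e1 einv d0; set d := ip f e.
(* Half of [d ^+ 2] is lost: a quarter in [ip h f] against [ip h h], and a quarter
   in replacing the average by [h]. *)
have d4 : 0 < d ^+ 2 / 4 by rewrite divr_gt0 // exprn_gt0.
have [k [lh]] := polynomial_mean_ergodic rP f1 d4.
set h := avg lh _ => -[k0 lh0 hf /(_ 1%N isT)[nu nu0 conv]].
exists k, nu; split=> // z.
have hd : d ^+ 2 <= ip h h.
  have <- : ip h e = d.
    rewrite /h ip_avgl -[RHS](@avg_cst R R^o _ lh) //.
    by apply: eq_avg => x; rewrite -{1}(einv x) ip_act.
  have he : 0 <= ip h e.
    rewrite /h ip_avgl -[0](@avg_cst R R^o _ lh) //; apply: ler_avgT => x.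
    by rewrite -(einv x) ip_act ltW.
  rewrite -sqr_nrm ler_sqr ?nnegrE ?nrm_ge0 //.
  apply: le_trans (ip_le_nrm _ _ _) _.
  by rewrite -[leRHS]mulr1 ler_wpM2l // nrm_ge0.
rewrite -ip_avgl.
set w := avg nu _.
have : nrm (w - h) <= d ^+ 2 / 4 by have := conv z; rewrite muln1.
move=> wh; have := norm_ip_le E (w - h) f; rewrite ipBl.
have : nrm (w - h) * nrm f <= d ^+ 2 / 4 * 1.
  by apply: ler_pM => //; exact: nrm_ge0.
by move=> ? /ler_normlP[? _]; lra.
Qed.

End Recurrence.
(** * Polynomial maps with integer values *)

Section DifferencesOfPowers.
Implicit Types f : int -> int.

Definition delta f x : int := f (x + 1) - f x.

(** Leibniz rule for the product of [f] with the identity. *)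
Lemma iter_delta_mulX k f x :
  iter k.+1 delta (fun y => y * f y) x
  = x * iter k.+1 delta f x + iter k delta f (x + 1) *+ k.+1.
Proof.
elim: k x => [|k IH] x; first by rewrite /= /delta; ring.
have iterE j g y : iter j.+1 delta g y = iter j delta g (y + 1) - iter j delta g y.
  by [].
rewrite iterE !IH (iterE k.+1 f x) (iterE k f (x + 1)).
rewrite [_ *+ k.+2]mulrSr mulrnBl.
set A := _ *+ k.+1; set B := _ *+ k.+1; ring.
Qed.

Lemma iter_delta_zero k f : (forall x, f x = 0) ->
  forall x, iter k delta f x = 0.
Proof. by move=> f0; elim: k => //= k IH x; rewrite /delta !IH subrr. Qed.

Lemma iter_delta_exp b x : iter b delta (fun y => y ^+ b) x = (b`!)%:Z.
Proof.
elim: b x => [|b IH] x; first by rewrite /= expr0.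
rewrite (_ : (fun y => y ^+ b.+1) = (fun y => y * y ^+ b)); last first.
  by apply/funext => y; rewrite exprS.
rewrite iter_delta_mulX iterS /delta !IH subrr mulr0 add0r factS PoszM.
by rewrite -mulr_natl natz.
Qed.

Lemma iter_delta_exp_gt a b x : (b < a)%N ->
  iter a delta (fun y => y ^+ b) x = 0.
Proof.
move=> ba; rewrite -(subnK ba) iterD; apply: iter_delta_zero => y.
by rewrite iterS /delta !iter_delta_exp subrr.
Qed.

End DifferencesOfPowers.

Section Monomials.
Variable d : nat.
Local Notation D := 'rV[int]_d.
Local Notation e_ i := (delta_mx 0 i : D).

Definition product_map (f : 'I_d -> int -> int) (n : D) : int :=
  \prod_i f i (n 0 i).

Lemma diffs_product_map (s : seq 'I_d) f n :
  diffs [seq e_ i | i <- s] (product_map f) n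
  = product_map (fun i => iter (count_mem i s) delta (f i)) n.
Proof.
elim: s f => [|i s IH] f //=.
pose g j := if j == i then delta (f j) else f j.
have -> : (fun m => product_map f (m + e_ i) - product_map f m)
          = product_map g.
  apply/funext => m; rewrite /product_map (bigD1 i) //.
  rewrite [X in _ - X](bigD1 i) // [RHS](bigD1 i) //= /g eqxx.
  rewrite !mxE !eqxx /= /delta mulrBl; congr (_ * _ - _ * _).
    apply: eq_bigr => j ji; rewrite !mxE eqxx /= (negPf ji) addr0.
    by [].
  by apply: eq_bigr => j ji; rewrite (negPf ji).
rewrite IH; apply: eq_bigr => j _; rewrite /g.
have [->|ji] := eqVneq j i; first by rewrite add1n iterSr.
by rewrite add0n.
Qed.

Definition monomial (m : mpoly.multinom d) (n : D) : int :=
  \prod_i n 0 i ^+ mpoly.fun_of_multinom m i.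

(** Each basis vector is repeated as often as its variable occurs in [m]. *)
Definition directions (m : mpoly.multinom d) : seq D :=
  [seq e_ i | i <- mpoly.m2s m].

Lemma count_m2s (m : mpoly.multinom d) i :
  count_mem i (mpoly.m2s m) = mpoly.fun_of_multinom m i.
Proof. by rewrite -[in RHS](mpoly.s2mK m) mpoly.mnmE. Qed.

Lemma diffs_monomial m n :
  diffs (directions m) (monomial m) n
  = (\prod_i (mpoly.fun_of_multinom m i)`!)%N%:Z.
Proof.
rewrite (diffs_product_map _ (fun i x => x ^+ mpoly.fun_of_multinom m i)).
rewrite (big_morph Posz PoszM (erefl _)); apply: eq_bigr => i _.
by rewrite count_m2s iter_delta_exp.
Qed.

Lemma diffs_lower_monomial (m m' : mpoly.multinom d) n :
  (mpoly.mdeg m' <= mpoly.mdeg m)%N -> m' != m ->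
  diffs (directions m) (monomial m') n = 0.
Proof.
move=> le_deg ne.
have [i lt_i] : exists i,
    (mpoly.fun_of_multinom m' i < mpoly.fun_of_multinom m i)%N.
  apply/existsP; apply: contraNT ne; rewrite negb_exists => /forallP ge.
  have {}ge i : (mpoly.fun_of_multinom m i <= mpoly.fun_of_multinom m' i)%N.
    by rewrite leqNgt ge.
  apply/eqP/mpoly.mnmP => i; apply/eqP; rewrite eqn_leq ge andbT.
  move: le_deg; rewrite !mpoly.mdegE (bigD1 i) //= [leqRHS](bigD1 i) //=.
  have : (\sum_(j < d | j != i) mpoly.fun_of_multinom m j
          <= \sum_(j < d | j != i) mpoly.fun_of_multinom m' j)%N.
    by apply: leq_sum.
  move=> leS leD; rewrite -(leq_add2r (\sum_(j < d | j != i)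
    mpoly.fun_of_multinom m j)).
  by apply: leq_trans leD; rewrite leq_add2l.
rewrite (diffs_product_map _ (fun i x => x ^+ mpoly.fun_of_multinom m' i)).
rewrite /product_map (bigD1 i) //= count_m2s iter_delta_exp_gt // mul0r.
by [].
Qed.

Lemma monomial_mulrn m n k :
  monomial m (n *+ k) = (k ^ mpoly.mdeg m)%N%:Z * monomial m n.
Proof.
rewrite /monomial mpoly.mdegE expn_sum (big_morph Posz PoszM (erefl _)).
rewrite -big_split /=; apply: eq_bigr => i _.
by rewrite mulmxnE -mulr_natl exprMn -natrX natz.
Qed.

Lemma diffs_mulrz (G : zmodType) (s : seq D) (c : G) (f : D -> int) n :
  diffs s (fun n => c *~ f n) n = c *~ diffs s f n.
Proof.
elim: s f => //= v s IH f; rewrite -IH; congr (diffs s _ n).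
by apply/funext => m; rewrite mulrzBr.
Qed.

(** Monomials of higher degree come first, because the directions of a monomial
    annihilate every other monomial of at most the same degree. *)
Lemma layered_monomials (G : zmodType) (c : mpoly.multinom d -> G)
    (ms : seq (mpoly.multinom d)) :
  uniq ms -> sorted (fun m m' => mpoly.mdeg m' <= mpoly.mdeg m)%N ms ->
  {in ms, forall m, 0 < mpoly.mdeg m}%N ->
  layered_polynomial (fun n => \sum_(m <- ms) c m *~ monomial m n).
Proof.
elim: ms => [|m ms IH] /=.
  rewrite (_ : (fun n => _) = fun=> 0); first by move=> *; constructor.
  by apply/funext => n; rewrite big_nil.
move=> /andP[mms ums] srt pos.
have ptr : transitive (fun m m' : mpoly.multinom d =>
    mpoly.mdeg m' <= mpoly.mdeg m)%N.
  by move=> a b e ba ae; apply: leq_trans ae ba.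
rewrite (_ : (fun n => _) =
  fun n => c m *~ monomial m n + \sum_(m <- ms) c m *~ monomial m n); last first.
  by apply/funext => n; rewrite big_cons.
have m0 : (0 < mpoly.mdeg m)%N by apply: pos; rewrite mem_head.
have : (0 < size (directions m))%N by rewrite size_map mpoly.size_m2s.
case eq_s : (directions m) => [//|v s] _.
apply: (@layeredS _ _ _ _ v s (\prod_i (mpoly.fun_of_multinom m i)`!)%N).
- by rewrite prodn_gt0 // => i; rewrite fact_gt0.
- move=> n; rewrite -eq_s diffsD diffs_mulrz diffs_monomial.
  have lower : {in ms, forall m',
      (mpoly.mdeg m' <= mpoly.mdeg m)%N && (m' != m)}.
    move=> m' m'ms; rewrite (allP (order_path_min ptr srt)) //.
    by apply: contraNneq mms => <-.
  rewrite -[RHS]addr0 pmulrn; congr (_ + _).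
  elim: (ms) lower => [|m' ms' IH'] lower.
    rewrite (_ : (fun n => _) = fun=> 0) ?diffs0 //.
    by apply/funext => x; rewrite big_nil.
  rewrite (_ : (fun n => _) =
    fun n => c m' *~ monomial m' n 
      + \sum_(m <- ms') c m *~ monomial m n); last first.
    by apply/funext => x; rewrite big_cons.
  have /andP[le_m ne_m] := lower m' (mem_head _ _).
  rewrite diffsD diffs_mulrz diffs_lower_monomial // mulr0z add0r IH' //.
  by move=> m'' m''ms; apply: lower; rewrite inE m''ms orbT.
- move=> k n; rewrite monomial_mulrn -(prednK m0) expnS PoszM -mulrA.
  by exists ((k ^ (mpoly.mdeg m).-1)%N%:Z * monomial m n).
apply: IH => //; first exact: path_sorted srt.
by move=> m' m'ms; apply: pos; rewrite inE m'ms orbT.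
Qed.

End Monomials.
Lemma common_denominator (xs : seq rat) :
  exists2 K : nat, (0 < K)%N &
    {in xs, forall x, exists z : int, x * K%:R = z%:~R}.
Proof.
elim: xs => [|x xs [K K0 IH]]; first by exists 1%N.
exists (`|denq x| * K)%N; first by rewrite muln_gt0 absz_gt0 denq_neq0.
move=> y; rewrite inE => /predU1P[->|/IH[z zE]].
  exists (numq x * K%:Z); rewrite natrM intrM numqE mulrA -pmulrn.
  by congr (_ * _ * _); rewrite -[in RHS](gtz0_abs (denq_gt0 x)).
by exists (z * `|denq x|%N%:Z); rewrite intrM -zE natrM -pmulrn; ring.
Qed.

Lemma mx_mulrzE (s e : nat) (A : 'M[int]_(s, e)) (z : int) i j :
  (A *~ z) i j = A i j *~ z.
Proof.
by case: z => k; rewrite ?NegzE ?mulrNz -!pmulrn ?mxE mulmxnE.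
Qed.

Section IntegerValued.
Variables (d s e : nat) (r : 'rV[int]_d -> 'M[int]_(s, e)).
Variable P : 'I_s -> 'I_e -> mpoly.mpoly d rat.
Hypothesis rP : forall x i j, (r x i j)%:~R =
  mpoly.meval (fun k : 'I_d => (x 0 k)%:~R) (P i j) :> rat.
Hypothesis r0 : r 0 = 0.

Lemma intr_monomial m (n : 'rV[int]_d) :
  (monomial m n)%:~R
  = \prod_i (n 0 i)%:~R ^+ mpoly.fun_of_multinom m i :> rat.
Proof.
rewrite /monomial (big_morph _ (intrM _) (erefl _)); apply: eq_bigr => i _.
by rewrite rmorphXn.
Qed.

(** At [n = 0] all monomials of positive degree vanish. *)
Lemma const_coef0 i j m : mpoly.mdeg m = 0%N -> mpoly.mcoeff m (P i j) = 0.
Proof.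
move=> m0; apply/eqP; rewrite mpoly.mcoeff_eq0; apply/negP => m_supp.
have := rP 0 i j; rewrite r0 mxE mpoly.mevalE (bigD1_seq m) //=.
rewrite [X in _ + X]big1 ?addr0 => [|m' m'm].
  rewrite big1 => [|k _]; last first.
    move/eqP: m0; rewrite mpoly.mdeg_eq0 => /eqP ->.
    by rewrite mpoly.mnm0E expr0.
  rewrite mulr1 => /esym/eqP; rewrite mpoly.mcoeff_eq0.
  by rewrite m_supp.
rewrite -intr_monomial.
have -> : (0 : 'rV[int]_d) = 0 *+ 0 by [].
rewrite monomial_mulrn exp0n ?mul0r ?mulr0 // lt0n.
apply: contraNneq m'm => m'0; move/eqP: m'0; rewrite mpoly.mdeg_eq0 => /eqP ->.
by move/eqP: m0; rewrite mpoly.mdeg_eq0 => /eqP ->.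
Qed.

(** Substituting [n *+ K] multiplies the coefficient of a monomial of positive
    degree by a multiple of [K], which clears the denominators. *)
Lemma layered_integer_polynomial :
  exists2 K, (0 < K)%N & layered_polynomial (fun n => r (n *+ K)).
Proof.
pose sup := flatten [seq mpoly.msupp (P ij.1 ij.2) | ij : 'I_s * 'I_e].
have supP i j m : m \in mpoly.msupp (P i j) -> m \in sup.
  move=> mP; apply/flattenP; exists (mpoly.msupp (P i j)) => //.
  by apply/mapP; exists (i, j); rewrite ?mem_enum.
pose coefs := [seq mpoly.mcoeff m (P ij.1 ij.2)
               | ij <- enum {: 'I_s * 'I_e}, m <- sup].
have [K K0 Kden] := common_denominator coefs; exists K => //.
pose rel (m m' : mpoly.multinom d) := (mpoly.mdeg m' <= mpoly.mdeg m)%N.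
pose ms := sort rel [seq m <- undup sup | (0 < mpoly.mdeg m)%N].
have msE m : (m \in ms) = (m \in sup) && (0 < mpoly.mdeg m)%N.
  by rewrite mem_sort mem_filter mem_undup andbC.
have /choice[c cE] : forall m, exists c : 'M[int]_(s, e), m \in ms ->
    forall i j, (c i j)%:~R = mpoly.mcoeff m (P i j) * K%:R ^+ mpoly.mdeg m.
  move=> m; have [mms|mms] := boolP (m \in ms); last by exists 0.
  move: mms; rewrite msE => /andP[msup m0].
  have /choice[z zE] : forall ij : 'I_s * 'I_e, exists z : int,
      z%:~R = mpoly.mcoeff m (P ij.1 ij.2) * K%:R ^+ mpoly.mdeg m.
    move=> ij; have [|z zE] := Kden (mpoly.mcoeff m (P ij.1 ij.2)).
      by apply/allpairsP; exists (ij, m); rewrite mem_enum.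
    exists (z * K%:Z ^+ (mpoly.mdeg m).-1).
    by rewrite intrM -zE rmorphXn /= -mulrA -pmulrn -exprS prednK.
  by exists (\matrix_(i, j) z (i, j)) => _ i j; rewrite mxE zE.
have -> : (fun n => r (n *+ K)) = fun n => \sum_(m <- ms) c m *~ monomial m n.
  apply/funext => n; apply/matrixP => i j.
  apply: (@intr_inj rat); rewrite rP mpoly.mevalE.
  rewrite summxE (big_morph _ (intrD _) (erefl _)).
  transitivity (\sum_(m <- ms) mpoly.mcoeff m (P i j)
      * \prod_(k < d) ((n *+ K) 0 k)%:~R ^+ mpoly.fun_of_multinom m k).
    rewrite -(@big_rmcond _ _ _ _ ms (fun m => m \in mpoly.msupp (P i j))) /=.
      rewrite -[RHS]big_filter; apply: perm_big; apply: uniq_perm.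
      - exact: mpoly.msupp_uniq.
      - by rewrite filter_uniq // sort_uniq filter_uniq // undup_uniq.
      move=> m; rewrite mem_filter msE; case: (boolP (m \in _)) => //= mP.
      rewrite (supP _ _ _ mP) lt0n; apply/esym/eqP => m0.
      by move: mP; rewrite mpoly.mcoeff_msupp const_coef0 ?eqxx.
    by move=> m /mpoly.memN_msupp_eq0 ->; rewrite mul0r.
  rewrite big_seq [RHS]big_seq; apply: eq_bigr => m mms.
  rewrite -intr_monomial monomial_mulrn mx_mulrzE.
  by rewrite -[c m i j *~ _]mulrzr intz !intrM cE // -mulrA -pmulrn natrX.
apply: layered_monomials.
- by rewrite sort_uniq filter_uniq // undup_uniq.
- by apply: sort_sorted => m m'; exact: leq_total.
- by move=> m; rewrite msE => /andP[].
Qed.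

End IntegerValued.
(** * Invariant means *)

Definition bounded_function (R : realType) (T : Type) (f : T -> R) : Prop :=
  exists M : R, forall x, `|f x| <= M.

Section Bounded.
Context {R : realType} {T : Type}.
Implicit Types f g : T -> R.

Lemma bounded_cst (c : R) : bounded_function (fun=> c : R : _) (T := T).
Proof. by exists `|c|. Qed.

Lemma bounded_lin a f g : bounded_function f -> bounded_function g ->
  bounded_function (fun x => a * f x + g x).
Proof.
move=> [M fM] [N gN]; exists (`|a| * M + N) => x.
by apply: le_trans (ler_normD _ _) _; rewrite normrM lerD // ler_wpM2l.
Qed.

Lemma bounded_mul f g : bounded_function f -> bounded_function g ->
  bounded_function (fun x => f x * g x).
Proof.
move=> [M fM] [N gN]; exists (M * N) => x; rewrite normrM.
by apply: ler_pM.
Qed.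

Lemma bounded_comp (T' : Type) (h : T' -> T) f :
  bounded_function f -> bounded_function (fun x => f (h x)).
Proof. by move=> [M fM]; exists M => x. Qed.

Lemma bounded_indic (A : set T) : bounded_function (\1_A : T -> R).
Proof. by exists 1 => x; rewrite indicE normr_nat lern1 leq_b1. Qed.

Lemma bounded_avg (X : Type) (l : seq X) (f : X -> T -> R) M :
  0 <= M -> (forall t x, `|f t x| <= M) ->
  bounded_function (fun x => avg (V := R^o) l (f^~ x)).
Proof. by move=> M0 fM; exists M => x; apply: avg_norm_le. Qed.

End Bounded.

(** Total on all real functions, so that no proof of boundedness is an argument;
    the axioms constrain it on the bounded ones only. *)
Record invariant_mean (R : realType) (G : zmodType) := InvariantMean {
  mean : (G -> R) -> R;
  mean_lin : forall a f g, bounded_function f -> bounded_function g ->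
    mean (fun x => a * f x + g x) = a * mean f + mean g;
  mean_ge0 : forall f, bounded_function f -> (forall x, 0 <= f x) -> 0 <= mean f;
  mean1 : mean (fun=> 1) = 1;
  mean_shift : forall f x, bounded_function f ->
    mean (fun y => f (y + x)) = mean f }.

(** The bound is uniform over all functions bounded by [1]; this uniformity is
    what passes to products. *)
Definition asymptotically_invariant (R : realType) (G : zmodType)
    (Psi : nat -> seq G) : Prop :=
  forall (x : G) (eps : R), 0 < eps -> \forall N \near \oo,
    forall f : G -> R, (forall y, `|f y| <= 1) ->
    `|avg (V := R^o) (Psi N) (fun y => f (y + x)) - avg (V := R^o) (Psi N) f|
    <= eps.

Section UltrafilterLimit.
Context {R : realType}.
Variable U : set_system nat.
Hypothesis ultraU : UltraFilter U.

Let properU : ProperFilter U. Proof. exact: ultra_proper. Qed.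
#[local] Existing Instance properU.

(** The image of an ultrafilter is an ultrafilter, and it lives on a compact
    segment. *)
Lemma ultra_cvg (u : nat -> R) : bounded_function u -> cvg (u n @[n --> U]).
Proof.
move=> [M uM].
have ultra_uU : UltraFilter (u n @[n --> U]).
  split; first exact: fmap_proper_filter.
  move=> H HP le; apply/seteqP; split => // A HA.
  have [//|UA] := in_ultra_setVsetC (u @^-1` A) ultraU.
  have HnA : H (~` A) by apply: le; exact: UA.
  by case: (filter_not_empty H); rewrite -(setICr A); exact: filterI.
have := @segment_compact R (- M) M; rewrite compact_ultra.
move=> /(_ _ ultra_uU)[|p [_ pu]]; last by apply/cvg_ex; exists p.
by apply: (@filterE _ U) => n /=; rewrite in_itv /= -ler_norml uM.
Qed.

End UltrafilterLimit.

(** The ultrafilter contains the set of the [N] with a large average of [g], which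
    is infinite; so the limit of these averages is large as well. *)
Lemma exists_invariant_mean (R : realType) (G : zmodType) (Psi : nat -> seq G)
    (g : G -> R) (delta : R) :
  asymptotically_invariant R Psi -> (forall N, 0 < size (Psi N))%N ->
  bounded_function g ->
  (forall N0, exists2 N, (N0 <= N)%N & delta <= avg (V := R^o) (Psi N) g) ->
  exists m : invariant_mean R G, delta <= mean m g.
Proof.
move=> inv Psi0 bg freq.
pose S := [set N | delta <= avg (V := R^o) (Psi N) g].
have properS : ProperFilter (within S \oo).
  apply: Build_ProperFilter_ex => A [N0 _ NA].
  by have [N le_N SN] := freq N0; exists N; apply: NA.
have [U [ultraU SU]] := ultraFilterLemma properS.
have properU : ProperFilter U by exact: ultra_proper.
have ooU (A : set nat) : (\forall N \near \oo, A N) -> U A.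
  by move=> nA; apply: SU; apply: filterS nA.
pose av f N := avg (V := R^o) (Psi N) f.
pose mu f := lim (av f N @[N --> U]).
have mu_cvg f : bounded_function f -> av f N @[N --> U] --> mu f.
  move=> [M fM]; apply: ultra_cvg; exists (Num.max 0 M) => N.
  by apply: avg_norm_le => [|x]; rewrite le_max ?lexx // fM orbT.
have mu_lin a f h : bounded_function f -> bounded_function h ->
    mu (fun x => a * f x + h x) = a * mu f + mu h.
  move=> bf bh; apply: cvg_lim => //.
  rewrite (_ : av _ = fun N => a * av f N + av h N); last first.
    apply/funext => N; rewrite /av /avg big_split -mulr_sumr scalerDr.
    by rewrite scalerAr.
  by apply: cvgD; [apply: cvgMr; exact: mu_cvg|exact: mu_cvg].
have mu_ge0 f : bounded_function f -> (forall x, 0 <= f x) -> 0 <= mu f.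
  move=> bf f0; apply: limr_ge.
    by apply/cvg_ex; exists (mu f); exact: mu_cvg.
  by apply: filterE => N; rewrite /av /avg mulr_ge0 ?invr_ge0 ?sumr_ge0.
have mu1 : mu (fun=> 1) = 1.
  apply: cvg_lim => //; rewrite (_ : av _ = fun=> 1); first exact: cvg_cst.
  by apply/funext => N; rewrite /av avg_cst.
have mu_shift f x : bounded_function f -> mu (fun y => f (y + x)) = mu f.
  move=> bf; apply/eqP; rewrite -subr_eq0 -normr_le0.
  apply/ler_addgt0Pr => e e0; rewrite add0r.
  have [M0 fM0] := bf; pose M := Num.max 1 M0.
  have M1 : 0 < M by rewrite lt_max ltr01.
  have fM y : `|f y / M| <= 1.
    rewrite normrM normfV (gtr0_norm M1) ler_pdivrMr // mul1r.
    by rewrite le_max fM0 orbT.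
  have bfx : bounded_function (fun y => f (y + x)) by apply: bounded_comp bf.
  have cv : `|av (fun y => f (y + x)) N - av f N| @[N --> U]
      --> `|mu (fun y => f (y + x)) - mu f|.
    by apply: cvg_norm; apply: cvgB; exact: mu_cvg.
  rewrite -(cvg_lim _ cv) //; apply: limr_le.
    by apply/cvg_ex; eexists; exact: cv.
  apply: ooU; have eM : 0 < e / M by rewrite divr_gt0.
  apply: filterS (inv x _ eM) => N /(_ (fun y => f y / M) fM).
  rewrite ler_pdivlMr // -[X in _ * X](gtr0_norm M1) -normrM mulrBl.
  rewrite /av /avg -!mulr_suml /GRing.scale /=.
  by rewrite -!mulrA mulVf ?mulr1 // gt_eqF.
exists (InvariantMean mu_lin mu_ge0 mu1 mu_shift) => /=.
apply: limr_ge; first by apply/cvg_ex; exists (mu g); exact: mu_cvg.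
by apply: SU; apply: (@filterE _ \oo) => N.
Qed.

Section MeanTheory.
Context {R : realType} {G : zmodType}.
Variable m : invariant_mean R G.
Implicit Types f g : G -> R.

Lemma mean_cst c : mean m (fun=> c) = c.
Proof.
have := mean_lin m c (bounded_cst 1) (bounded_cst 0).
have := mean_lin m (-1) (bounded_cst 1) (bounded_cst 1).
rewrite !mean1 (_ : (fun=> -1 * 1 + 1) = (fun=> 0)); last first.
  by apply/funext => x; lra.
rewrite (_ : (fun=> c * 1 + 0) = (fun=> c)); last by apply/funext => x; lra.
by move=> -> ->; lra.
Qed.

Lemma meanZ a f : bounded_function f -> mean m (fun x => a * f x) = a * mean m f.
Proof.
move=> bf; rewrite -[RHS]addr0 -[X in _ + X](mean_cst 0).
rewrite -mean_lin //; last exact: bounded_cst.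
by congr (mean m _); apply/funext => x; rewrite addr0.
Qed.

Lemma meanD f g : bounded_function f -> bounded_function g ->
  mean m (fun x => f x + g x) = mean m f + mean m g.
Proof.
move=> bf bg; rewrite -[mean m f]mul1r -mean_lin //.
by congr (mean m _); apply/funext => x; rewrite mul1r.
Qed.

Lemma mean_le f g : bounded_function f -> bounded_function g ->
  (forall x, f x <= g x) -> mean m f <= mean m g.
Proof.
move=> bf bg fg; rewrite -subr_ge0 addrC -mulN1r -mean_lin //.
apply: mean_ge0 => [|x]; first exact: bounded_lin.
by rewrite mulN1r addrC subr_ge0.
Qed.

Lemma mean_avg (X : Type) (l : seq X) (f : X -> G -> R) :
  (forall t, bounded_function (f t)) ->
  mean m (fun x => avg (V := R^o) l (f^~ x))
  = avg (V := R^o) l (fun t => mean m (f t)).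
Proof.
move=> bf; pose b x := \sum_(t <- l) f t x.
have [bb bE] : bounded_function b /\ mean m b = \sum_(t <- l) mean m (f t).
  rewrite /b; elim: l {b} => [|t l [IHb IH]].
    rewrite big_nil (_ : (fun x => _) = fun=> 0); last first.
      by apply/funext => x; rewrite big_nil.
    by rewrite mean_cst; split => //; exact: bounded_cst.
  rewrite big_cons (_ : (fun x => _) = fun x => f t x + \sum_(t <- l) f t x).
    rewrite meanD // IH; split => //.
    have := bounded_lin 1 (bf t) IHb; congr bounded_function.
    by apply/funext => x; rewrite mul1r.
  by apply/funext => x; rewrite big_cons.
by rewrite /avg -bE /GRing.scale /= -meanZ.
Qed.

End MeanTheory.
(** * The pre-Hilbert space of an invariant mean *)

Section BoundedSpace.
Variables (R : realType) (T : Type).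

Definition bounded_pred : {pred T -> R} :=
  fun f => `[< bounded_function f >].

Lemma bounded_pred_closed : submod_closed bounded_pred.
Proof.
split; first by apply/asboolP; exact: (@bounded_cst R T 0).
move=> a f g /asboolP bf /asboolP bg; apply/asboolP.
exact: bounded_lin.
Qed.

HB.instance Definition _ :=
  GRing.isSubmodClosed.Build R (T -> R) bounded_pred bounded_pred_closed.

Record bounded_space :=
  BoundedSpace { bval :> T -> R; bvalP : bval \in bounded_pred }.

HB.instance Definition _ := [isSub for bval].
HB.instance Definition _ := [Choice of bounded_space by <:].
HB.instance Definition _ := [SubChoice_isSubLmodule of bounded_space by <:].

Lemma bspaceP (f : bounded_space) : bounded_function f.
Proof. by apply/asboolP; exact: bvalP. Qed.

Definition to_bspace (f : T -> R) (bf : bounded_function f) : bounded_space :=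
  BoundedSpace (introT (asboolP _) bf).

End BoundedSpace.

Section MeanAction.
Context {R : realType} {G : zmodType}.
Variable m : invariant_mean R G.
Local Notation V := (bounded_space R G).

Definition mean_ip (f g : V) : R := mean m (fun x => f x * g x).

Definition translation (x : G) (f : V) : V :=
  to_bspace (bounded_comp (fun y => y + x) (bspaceP f)).

Lemma mean_ipC f g : mean_ip f g = mean_ip g f.
Proof. by congr (mean m _); apply/funext => x; rewrite mulrC. Qed.

Lemma mean_ip_lin (h : V) a (f g : V) :
  mean_ip (a *: f + g) h = a * mean_ip f h + mean_ip g h.
Proof.
rewrite /mean_ip -mean_lin.
- by congr (mean m _); apply/funext => x; rewrite /= mulrDl mulrA.
- by apply: bounded_mul; exact: bspaceP.
- by apply: bounded_mul; exact: bspaceP.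
Qed.

Lemma mean_ip_ge0 f : 0 <= mean_ip f f.
Proof.
apply: mean_ge0 => [|x]; first by apply: bounded_mul; exact: bspaceP.
by rewrite -expr2 sqr_ge0.
Qed.

Lemma translation_lin x a f g :
  translation x (a *: f + g) = a *: translation x f + translation x g.
Proof. exact: val_inj. Qed.

Lemma translation0 f : translation 0 f = f.
Proof. by apply: val_inj; apply/funext => y; rewrite /= addr0. Qed.

Lemma translationD x y f : translation (x + y) f = translation x (translation y f).
Proof. by apply: val_inj; apply/funext => z; rewrite /= addrA. Qed.

Lemma mean_ip_translation x f g :
  mean_ip (translation x f) (translation x g) = mean_ip f g.
Proof.
apply: (mean_shift m (f := fun y => f y * g y)).
by apply: bounded_mul; exact: bspaceP.
Qed.

Definition mean_action : isometric_action G V :=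
  IsometricAction mean_ipC mean_ip_lin mean_ip_ge0 translation_lin translation0
    translationD mean_ip_translation.

(** The set version of recurrence: take for [f] the indicator function of [A] and
    for the invariant vector the constant [1]. *)
Lemma mean_polynomial_recurrence (D : zmodType) (r : D -> G) (A : set G) :
  layered_polynomial r -> 0 < mean m \1_A ->
  exists k (l : seq D) c, [/\ (0 < k)%N, (0 < size l)%N, 0 < c & forall z,
    c <= avg (V := R^o) l
           (fun t => mean m (fun y => \1_A (y + r ((z + t) *+ k)) * \1_A y))].
Proof.
move=> rP A0.
pose f : V := to_bspace (bounded_indic A).
pose e : V := to_bspace (bounded_cst 1).
have le1 (g : V) : (forall x, `|g x| <= 1) -> nrm mean_action g <= 1.
  move=> g1; rewrite nrm_leP // expr1n /= /mean_ip -(mean_cst m 1).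
  apply: mean_le => [||x]; first by apply: bounded_mul; exact: bspaceP.
    exact: bounded_cst.
  by rewrite -expr2 -real_normK ?num_real // expr_le1.
have fe : ip mean_action f e = mean m \1_A.
  by congr (mean m _); apply/funext => x; rewrite /= mulr1.
have [||x||k [l [k0 l0 rec]]] := polynomial_recurrence (E := mean_action)
    (f := f) (e := e) rP.
- by apply: le1 => x; rewrite /= indicE normr_nat lern1 leq_b1.
- by apply: le1 => x; rewrite /= normr1.
- by apply: val_inj.
- by rewrite fe.
exists k, l, (mean m \1_A ^+ 2 / 2); split=> // [|z].
  by rewrite divr_gt0 // exprn_gt0.
by rewrite -fe; exact: rec.
Qed.

End MeanAction.
(** * Averages along Følner sequences *)

Section Folner.
Context {R : realType} {G : countZmodType}.

Lemma sum_shift_le_symdiff (F : {fset G}) (f : G -> R) (x : G) (B : R) :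
  (forall y, `|f y| <= B) ->
  `|\sum_(y <- F) f (y + x) - \sum_(y <- F) f y|
  <= #|` symdiff (translate x F) F|%:R * B.
Proof.
move=> fB; set F' := translate x F.
have -> : \sum_(y <- F) f (y + x) = \sum_(y <- F') f y.
  rewrite /F' /translate big_imfset /=; last by move=> y z _ _; exact: addrI.
  by apply: eq_bigr => y _; rewrite addrC.
have bound (K : {fset G}) : `|\sum_(y <- K) f y| <= #|` K|%:R * B.
  apply: (le_trans (ler_norm_sum _ _ _)).
  apply: (le_trans (ler_sum _ (fun y _ => fB y))).
  by rewrite big_const_seq count_predT iter_addr_0 mulr_natl.
rewrite (big_fsetID _ (mem F) F') (big_fsetID _ (mem F') F) /=.
have -> : [fset y in F' | y \in F]%fset = [fset y in F | y \in F']%fset.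
  by apply/fsetP => y; rewrite !inE andbC.
rewrite opprD addrACA subrr add0r.
apply: le_trans (ler_normB _ _) _.
have -> : [fset y in F' | y \notin F]%fset = (F' `\` F)%fset.
  by apply/fsetP => y; rewrite !inE andbC.
have -> : [fset y in F | y \notin F']%fset = (F `\` F')%fset.
  by apply/fsetP => y; rewrite !inE andbC.
apply: le_trans (lerD (bound _) (bound _)) _.
rewrite -mulrDl -natrD /symdiff -cardfsUI.
have -> : ((F' `\` F) `&` (F `\` F'))%fset = fset0.
  by apply/fsetP => y; rewrite !inE; case: (y \in F); case: (y \in F').
by rewrite cardfs0 addn0.
Qed.

Lemma folner_size_gt0 (F : nat -> {fset G}) N :
  folner R F -> (0 < #|` F N|)%N.
Proof. by move=> [F0 _]; rewrite cardfs_gt0 F0. Qed.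

Lemma folner_invariant (F : nat -> {fset G}) :
  folner R F -> asymptotically_invariant R (fun N => F N : seq G).
Proof.
move=> Ff x e e0; have [F0 /(_ x)] := Ff.
move=> /cvgr0_norm_le/(_ e e0); apply: filterS => N leN f f1.
have F_gt0 : 0 < #|` F N|%:R :> R by rewrite ltr0n folner_size_gt0.
rewrite /avg -scalerBr normrZ normfV (gtr0_norm F_gt0) mulrC ler_pdivrMr //.
have le1 : #|` symdiff (translate x (F N)) (F N)|%:R * 1 <= e * #|` F N|%:R.
  rewrite mulr1 -ler_pdivrMr //; apply: le_trans leN.
  exact: ler_norm.
have le2 := sum_shift_le_symdiff (F N) x f1.
exact: le_trans le2 le1.
Qed.

Lemma density_avgE (F : {fset G}) (A : set G) :
  #|` [fset x in F | x \in A]%fset|%:R / #|` F|%:R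
  = avg (V := R^o) F (\1_A : G -> R).
Proof.
rewrite /avg /GRing.scale /= mulrC; congr (_ * _).
rewrite card_fset_sum1 -big_fset_condE /= natr_sum big_mkcond /=.
by apply: eq_bigr => x _; rewrite indicE; case: (x \in A).
Qed.

End Folner.

Lemma limn_esup_gt0_freq (R : realType) (u : nat -> R) :
  (0 < limn_esup (fun N => (u N)%:E))%E ->
  exists2 delta, 0 < delta &
    forall N0, exists2 N, (N0 <= N)%N & delta <= u N.
Proof.
move=> u0.
have [delta d0 dlim] : exists2 delta : R, 0 < delta &
    (delta%:E < limn_esup (fun N => (u N)%:E))%E.
  move: u0; case: (limn_esup _) => [a| |] //.
    by rewrite lte_fin => a0; exists (a / 2); rewrite ?lte_fin; lra.
  by move=> _; exists 1; rewrite ?ltry.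
exists delta => // N0.
have /ereal_sup_gt[_ [N NN0 <-]] :
    (delta%:E < ereal_sup [set (u N)%:E | N in [set N | (N0 <= N)%N]])%E.
  apply: lt_le_trans dlim _; rewrite /limn_esup limf_esupE.
  apply: ereal_inf_lbound; exists [set N | (N0 <= N)%N] => //.
  exact: nbhs_infty_ge.
by rewrite lte_fin => /ltW; exists N.
Qed.

Lemma limn_esup_gt0 (R : realType) (u : nat -> R) delta : 0 < delta ->
  (forall N0, exists2 N, (N0 <= N)%N & delta <= u N) ->
  (0 < limn_esup (fun N => (u N)%:E))%E.
Proof.
move=> d0 freq; apply: (@lt_le_trans _ _ delta%:E); first by rewrite lte_fin.
rewrite /limn_esup limf_esupE; apply: le_ereal_inf_tmp => _ [V [N0 _ NV] <-].
have [N leN uN] := freq N0.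
apply: le_ereal_sup_tmp; exists (u N)%:E; last by rewrite lee_fin.
by exists N => //; apply: NV.
Qed.
(** Lists of matrices with rows from [Psi N], one row at a time.  Translating a
    matrix changes its first row and the rest separately; for the rest, the bound
    of the induction hypothesis holds whatever the first row is. *)
Lemma asymptotically_invariant_power (R : realType) (e s : nat)
    (Psi : nat -> seq 'rV[int]_e) (A : set 'rV[int]_e) :
  asymptotically_invariant R Psi -> (forall N, 0 < size (Psi N))%N ->
  exists Psi' : nat -> seq 'M[int]_(s, e),
    [/\ asymptotically_invariant R Psi', forall N, (0 < size (Psi' N))%N &
      forall N, avg (V := R^o) (Psi' N) \1_[set a | forall i, A (row i a)]
                = avg (V := R^o) (Psi N) \1_A ^+ s].
Proof.
move=> inv Psi0; elim: s => [|s [Psi' [inv' Psi'0 indE]]].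
  exists (fun=> [:: 0]); split=> // [x eps eps0|N].
    apply: nearW => N f _; rewrite (_ : (fun y => f (y + x)) = f).
      by rewrite subrr normr0 ltW.
    by apply/funext => y; congr f; apply/matrixP => -[].
  rewrite /avg big_seq1 invr1 scale1r expr0 indicE mem_set //=.
  by case.
exists (fun N =>
  [seq (col_mx u v : 'M[int]_(1 + s, e)) | u <- Psi N, v <- Psi' N]).
split=> [x eps eps0|N|N]; last 1 first.
- rewrite avg_allpairs exprS -indE.
  transitivity (avg (V := R^o) (Psi N) (fun u => \1_A u
      * avg (V := R^o) (Psi' N) \1_[set a | forall i, A (row i a)])).
    apply: eq_avg => u.
    transitivity (avg (V := R^o) (Psi' N) (fun v =>
        (\1_A u : R) * \1_[set a | forall i, A (row i a)] v)).
      apply: eq_avg => v; rewrite !indicE -natrM mulnb; congr (nat_of_bool _)%:R.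
      apply/idP/andP => [/set_mem H|[/set_mem Au /set_mem Av]].
        split; apply/mem_set; last move=> i.
          by have := H (@lshift 1 s ord0); rewrite (@rowKu int 1 s e) row_id.
        by rewrite /= -(@rowKd int 1 s e i u v); exact: (H (@rshift 1 s i)).
      apply/mem_set => i; case: (@split_ordP 1 s i) => j ->.
        by rewrite (@rowKu int 1 s e) row_id.
      by rewrite (@rowKd int 1 s e); exact: Av.
    apply/esym/(@avg_morph R R^o R^o (fun w : R^o => (\1_A u : R) * w)).
    by move=> a v w; rewrite /GRing.scale /= mulrDr mulrCA.
  by rewrite /avg -mulr_suml /GRing.scale /= mulrA.
- have eps2 : 0 < eps / 2 by rewrite divr_gt0.
  pose xu := @usubmx int 1 s e x; pose xd := @dsubmx int 1 s e x.
  apply: filterS2 (inv xu _ eps2) (inv' xd _ eps2) => N near1 near2 f f1.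
  rewrite !avg_allpairs.
  pose g u := avg (V := R^o) (Psi' N) (fun v => f (@col_mx int 1 s e u v)).
  have -> : avg (V := R^o) (Psi N) (fun u => avg (V := R^o) (Psi' N)
      (fun v => f (@col_mx int 1 s e u v + x))) - avg (V := R^o) (Psi N) g =
    avg (V := R^o) (Psi N) (fun u => avg (V := R^o) (Psi' N)
      (fun v => f (@col_mx int 1 s e (u + xu) (v + xd))) - g (u + xu))
    + (avg (V := R^o) (Psi N) (fun u => g (u + xu))
       - avg (V := R^o) (Psi N) g).
    rewrite avgB subrKA; congr (_ - _); apply: eq_avg => u; apply: eq_avg => v.
    have -> : x = col_mx xu xd by rewrite (@vsubmxK int 1 s e).
    by rewrite add_col_mx.
  rewrite (_ : eps = eps / 2 + eps / 2); last by field.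
  apply: le_trans (ler_normD _ _) _; apply: lerD; last first.
    by apply: near1 => u; apply: avg_norm_le.
  apply: avg_norm_le => [|u]; first exact: ltW.
  by apply: (near2 (fun v => f (@col_mx int 1 s e (u + xu) v))).
- by rewrite size_allpairs muln_gt0 Psi0 Psi'0.
Qed.

(** * Points that recur infinitely often *)

Section Intersectivity.
Context {R : realType} {G : zmodType}.
Variable m : invariant_mean R G.
Local Notation mu A := (mean m (\1_A : G -> R)).

Lemma mean_indic_subset (A B : set G) : A `<=` B -> mu A <= mu B.
Proof.
move=> AB; apply: mean_le; [exact: bounded_indic|exact: bounded_indic|move=> x].
rewrite !indicE ler_nat; case: (boolP (x \in A)) => // /set_mem/AB xB.
by rewrite mem_set.
Qed.

Lemma mean_indicU_le (A B : set G) : mu (A `|` B) <= mu A + mu B.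
Proof.
rewrite -meanD; try exact: bounded_indic.
apply: mean_le => [||x]; first exact: bounded_indic.
  have := bounded_lin 1 (@bounded_indic R G A) (@bounded_indic R G B).
  by congr bounded_function; apply/funext => x; rewrite mul1r.
rewrite !indicE in_setU -natrD ler_nat.
by case: (x \in A); case: (x \in B).
Qed.

Lemma mean_indicD (A B : set G) : mu (A `\` B) = mu (A `|` B) - mu B.
Proof.
apply/eqP; rewrite eq_sym subr_eq -meanD; try exact: bounded_indic.
apply/eqP; congr (mean m _); apply/funext => x.
rewrite !indicE in_setU in_setD -natrD; congr (_%:R).
by case: (x \in A); case: (x \in B).
Qed.

(** A mean being only finitely additive, Fatou's lemma does not apply to the
    sets [E k].  Instead, [M j] is chosen so large that the union [H j] of the
    sets [E k] with [j <= k < M j] nearly exhausts the measure of all such finite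
    unions.  Then [H (j + 1)] is almost contained in [H j], and
    [H 0, ..., H n] keep a common part of positive measure for every [n]. *)
Lemma infinitely_recurrent_points (E : nat -> set G) (c : R) (N0 : nat) :
  0 < c -> (forall N, (N0 <= N)%N -> c <= mu (E N)) ->
  exists M : nat -> nat, forall n, exists a, forall j, (j <= n)%N ->
    exists2 k, (j <= k < M j)%N & E k a.
Proof.
move=> c0 Ec.
pose U j M : set G := [set a | exists2 k, (j <= k < M)%N & E k a].
(* These errors sum to [c / 2], while each [H n] has measure at least [c]. *)
pose eps j : R := c / 2 * 2^-1 ^+ j.+1.
have eps0 j : 0 < eps j by rewrite mulr_gt0 ?exprn_gt0 // divr_gt0.
have U_sub j M M' : (M <= M')%N -> U j M `<=` U j M'.
  move=> le a [k /andP[jk kM] Eka]; exists k => //.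
  by rewrite jk (leq_trans kM).
have mu_le1 A : mu A <= 1.
  rewrite -(mean1 m); apply: mean_le => [||x].
  - exact: bounded_indic.
  - exact: bounded_cst.
  - by rewrite indicE lern1 leq_b1.
have /choice[M MP] : forall j, exists M,
    c <= mu (U j M) /\ forall M', mu (U j M') <= mu (U j M) + eps j.
  move=> j.
  have hS : has_sup [set mu (U j M) | M in [set: nat]].
    split; first by exists (mu (U j 0%N)), 0%N.
    by exists 1 => _ [M _ <-].
  have [_ [M _ <-] lt] := sup_adherent (eps0 j) hS.
  (* Enlarging [M] keeps it nearly optimal and makes [U j M] contain one of the
     sets [E k] that are known to be large. *)
  exists (maxn M (maxn j N0).+1); split.
    apply: le_trans (Ec (maxn j N0) (leq_maxr _ _)) (mean_indic_subset _).
    by move=> a Ea; exists (maxn j N0); rewrite // leq_maxl leq_maxr.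
  move=> M'; have le1 : mu (U j M) <= mu (U j (maxn M (maxn j N0).+1)).
    by apply: mean_indic_subset; apply: U_sub; exact: leq_maxl.
  have le2 : mu (U j M') <= sup [set mu (U j M) | M in [set: nat]].
    by apply: sup_ubound; [case: hS|exists M'].
  by lra.
exists M => n.
pose H j := U j (M j).
pose K n : set G := [set a | forall j, (j <= n)%N -> H j a].
have small i : mu (H i `\` K i) <= c / 2 * (1 - 2^-1 ^+ i).
  elim: i => [|i IH].
    rewrite expr0 subrr mulr0 (_ : H 0%N `\` K 0%N = set0).
      by rewrite indic0 mean_cst.
    rewrite -subset0 => a [Ha]; apply => j; rewrite leqn0 => /eqP ->.
    exact: Ha.
  have sub : H i.+1 `\` K i.+1 `<=` (H i.+1 `\` H i) `|` (H i `\` K i).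
    move=> a [Ha nK]; have [Hi|nHi] := pselect (H i a); [right|by left].
    split=> // Ki; apply: nK => j; rewrite leq_eqVlt => /predU1P[->//|].
    by rewrite ltnS; exact: Ki.
  apply: le_trans (mean_indic_subset sub) _.
  apply: le_trans (mean_indicU_le _ _) _.
  have le1 : mu (H i.+1 `\` H i) <= eps i.
    rewrite mean_indicD lerBlDl; have [_ Mi] := MP i.
    apply: le_trans (Mi (maxn (M i) (M i.+1))).
    apply: mean_indic_subset => a [|].
      move=> [k /andP[ik kM] Eka]; exists k => //.
      by rewrite (ltnW ik) (leq_trans kM) // leq_maxr.
    by apply: U_sub; rewrite leq_maxl.
  move: le1 IH; rewrite /eps exprS; lra.
apply: contrapT => nex.
have K0 : K n = set0.
  rewrite -subset0 => a Ka; apply: nex; exists a => j jn.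
  by have [k kM Eka] := Ka j jn; exists k.
have := small n; rewrite K0 setD0; have [le _] := MP n.
have : 0 <= (2^-1 : R) ^+ n by rewrite exprn_ge0.
have : 0 <= c / 2 * 2^-1 ^+ n by rewrite mulr_ge0 ?exprn_ge0 ?divr_ge0 // ltW.
move: le; rewrite -/(H n); lra.
Qed.

End Intersectivity.
(** * Positive density along an arbitrary Følner sequence *)

Lemma filter_in_seq (T : Type) (X : eqType) (F : set_system T) (s : seq X)
    (P : X -> T -> Prop) : Filter F ->
  {in s, forall x, F (P x)} -> F [set t | {in s, forall x, P x t}].
Proof.
move=> FF; elim: s => [|x s IH] sP; first by apply: filterE.
have Fs : F [set t | {in s, forall x, P x t}].
  by apply: IH => y ys; apply: sP; rewrite inE ys orbT.
apply: filterS2 (sP x (mem_head _ _)) Fs => t Pt Ps y.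
by rewrite inE => /predU1P[->//|]; exact: Ps.
Qed.

(** Recurrence is established at multiples of [k] only; this brings an arbitrary
    point there by one of finitely many translations. *)
Lemma residue_translations (d k : nat) : (0 < k)%N ->
  exists2 box : seq 'rV[int]_d, (0 < size box)%N &
    forall n : 'rV[int]_d, exists2 rho, rho \in box & exists z, n + rho = z *+ k.
Proof.
case: k => // k _.
pose v (w : {ffun 'I_d -> 'I_k.+1}) : 'rV[int]_d := \row_i (w i : nat)%:Z.
exists [seq v w | w <- enum {ffun 'I_d -> 'I_k.+1}].
  by rewrite size_map -cardE card_ffun card_ord expn_gt0.
move=> n; pose w : {ffun 'I_d -> 'I_k.+1} :=
  [ffun i => inord (absz (modz (- n 0 i) k.+1))].
have wE i : (w i : nat)%:Z = modz (- n 0 i) k.+1.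
  have m0 : 0 <= modz (- n 0 i) k.+1 by rewrite modz_ge0.
  rewrite ffunE inordK ?gez0_abs // -ltz_nat gez0_abs //.
  by rewrite ltz_pmod.
exists (v w); first by apply/mapP; exists w; rewrite ?mem_enum.
exists (\row_i - (divz (- n 0 i) k.+1)).
apply/rowP => i; rewrite mulmxnE !mxE wE -mulr_natr natz.
by rewrite -(opprK (n 0 i)) {1}(divz_eq (- n 0 i) k.+1) opprK; ring.
Qed.

Section PatternDensity.
Context {R : realType} {d : nat}.
Local Notation D := 'rV[int]_d.

(** A Følner average hardly changes when [psi] is translated, so [psi] may be
    replaced by its average over the translations in [S]. *)
Lemma folner_average_ge (F : nat -> {fset D}) (psi : D -> R) (S : seq D) c :
  folner R F -> (0 < size S)%N -> 0 < c ->
  (forall n, `|psi n| <= 1) ->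
  (forall n, c <= avg (V := R^o) S (fun y => psi (n + y))) ->
  \forall N \near \oo, c / 2 <= avg (V := R^o) (F N) psi.
Proof.
move=> Ff S0 c0 psi1 psiS; have c2 : 0 < c / 2 by rewrite divr_gt0.
have : \forall N \near \oo, {in S, forall y,
    avg (V := R^o) (F N) (fun n => psi (n + y))
    <= avg (V := R^o) (F N) psi + c / 2}.
  elim: S {S0 psiS} => [|y S IH]; first by apply: nearW.
  apply: filterS2 (folner_invariant Ff y c2) IH => N near1 near2 y'.
  rewrite inE => /predU1P[->|/near2//].
  by have /ler_normlP[_] := near1 psi psi1; rewrite lerBlDl.
apply: filterS => N nearS.
have F0 := folner_size_gt0 N Ff.
have : c <= avg (V := R^o) S
    (fun y => avg (V := R^o) (F N) (fun n => psi (n + y))).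
  rewrite avg_exchange -[leLHS](@avg_cst R R^o _ (F N : seq D) c) //.
  by apply: ler_avgT.
move=> /le_trans/(_ (ler_avg nearS)); rewrite avg_cst //; lra.
Qed.

Variables (G : zmodType) (m : invariant_mean R G) (A : set G).
Variables (P Q : D -> G) (K : nat) (F : nat -> {fset D}).
Hypothesis K0 : (0 < K)%N.
Hypothesis PQ : layered_polynomial (fun n => P (n *+ K) + Q (n *+ K)).
Hypothesis A0 : 0 < mean m \1_A.
Hypothesis folnerF : folner R F.

Let psi n : R := mean m (fun y => \1_A (y + (P n + Q n)) * \1_A y).

Let psi_bounds n : 0 <= psi n <= 1.
Proof.
have b : bounded_function (fun y => \1_A (y + (P n + Q n)) * \1_A y : R).
  apply: bounded_mul; last exact: bounded_indic.
  by apply: (bounded_comp (fun y => y + _)); exact: bounded_indic.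
apply/andP; split; first by apply: mean_ge0 => // x; rewrite !indicE mulr_ge0.
rewrite -(mean1 m); apply: mean_le; [exact: b|exact: bounded_cst|move=> x].
by rewrite !indicE -natrM mulnb lern1 leq_b1.
Qed.

Lemma folner_recurrence : exists2 c, 0 < c &
  \forall N \near \oo, c <= avg (V := R^o) (F N) psi.
Proof.
have [k [l [c [k0 l0 c0 rec]]]] := mean_polynomial_recurrence PQ A0.
have kK : (0 < k * K)%N by rewrite muln_gt0 k0.
have [box box0 boxP] := residue_translations d kK.
pose S := [seq rho + t *+ (k * K) | rho <- box, t <- l].
pose c' := c / (size box)%:R.
have c'0 : 0 < c' by rewrite divr_gt0 // ltr0n.
exists (c' / 2); first by rewrite divr_gt0.
apply: (@folner_average_ge F psi S) => // [||n].
- exact: size_allpairs_gt0.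
- by move=> n; have /andP[p0 p1] := psi_bounds n; rewrite ger0_norm.
rewrite /S avg_allpairs; have [rho rho_box [z nz]] := boxP n.
rewrite /avg /GRing.scale /= /c' mulrC ler_pM2l ?invr_gt0 ?ltr0n //.
rewrite (big_rem rho) //= -[leLHS]addr0; apply: lerD.
  apply: le_trans (rec z) _; rewrite le_eqVlt; apply/orP; left; apply/eqP.
  apply: eq_avg => t; rewrite /psi addrA nz -mulrnDl mulrnA.
  by [].
apply: sumr_ge0 => rho' _; apply: mulr_ge0; first by rewrite invr_ge0.
apply: sumr_ge0 => t _.
by have /andP[] := psi_bounds (n + (rho' + t *+ (k * K))).
Qed.

(** For one point [a], let [b] be good when [a + P b] and [a - Q b] are in [A]; then
    [P b + Q b'] is a difference of two points of [A] for all good [b] and [b'].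
    The mean over [a] of the density of the good [b] in [F N] is the average of
    [psi] over [F N], so for large [N] many [a] have many good [b].  No single
    [a] need work for infinitely many [N], but the points [a n] of
    [infinitely_recurrent_points] work for more and more [N], and [B] collects the
    [b] that are good for [a n] along an ultrafilter. *)
Lemma pattern_density : exists2 B : set D,
  (0 < upper_density R F B)%E &
  forall b b', B b -> B b' -> diffset A A (P b + Q b').
Proof.
have [c c0 [N0 _ cN]] := folner_recurrence.
pose good a n := A (a + P n) /\ A (a - Q n).
pose ind a n : R := \1_A (a + P n) * \1_A (a - Q n).
have indE a n : ind a n = (\1_[set n | good a n] n).
  rewrite /ind !indicE -natrM mulnb; congr (nat_of_bool _)%:R.
  apply/andP/idP => [[/set_mem a1 /set_mem a2]|/set_mem[a1 a2]].
    by apply/mem_set.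
  by split; apply/mem_set.
have ind01 a n : 0 <= ind a n <= 1 by rewrite indE indicE ler0n lern1 leq_b1.
have bind n : bounded_function (ind^~ n).
  by exists 1 => a; have /andP[p0 p1] := ind01 a n; rewrite ger0_norm.
pose dens N a := avg (V := R^o) (F N) (ind a).
have bdens N : bounded_function (dens N).
  apply: (@bounded_avg R G _ (F N : seq D) (fun n a => ind a n) 1) => // n a.
  by have /andP[p0 p1] := ind01 a n; rewrite ger0_norm.
have mean_dens N : mean m (dens N) = avg (V := R^o) (F N) psi.
  rewrite /dens (mean_avg m (F N : seq D) bind); apply: eq_avg => n.
  rewrite -[LHS](mean_shift m (Q n)) //.
  by congr (mean m _); apply/funext => y; rewrite /ind addrK addrAC addrA.
pose E N := [set a | c / 2 <= dens N a].
have c2 : 0 < c / 2 by rewrite divr_gt0.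
have cE N : (N0 <= N)%N -> c / 2 <= mean m \1_(E N).
  move=> leN; have := cN N leN; rewrite -mean_dens => le1.
  have le2 : mean m (dens N) <= mean m (fun a => 1 * \1_(E N) a + c / 2).
    apply: mean_le => // [|a].
      by apply: bounded_lin; [exact: bounded_indic|exact: bounded_cst].
    rewrite mul1r indicE; case: (boolP (a \in E N)) => [_|nE].
      have : dens N a <= 1.
        rewrite -(@avg_cst R R^o _ (F N : seq D) 1); last first.
          exact: folner_size_gt0 folnerF.
        by apply: ler_avgT => n; case/andP: (ind01 a n).
      by rewrite /= mulr1n; move: c2; lra.
    rewrite /= mulr0n add0r ltW // ltNge; apply/negP => Ea.
    by move/negP: nE; apply; apply/mem_set.
  move: le2; rewrite mean_lin ?mean_cst //; last exact: bounded_cst.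
    by move: le1; lra.
  exact: bounded_indic.
have [M MP] := infinitely_recurrent_points c2 cE.
have /choice[a aP] := MP.
have [U [ultraU ooU]] := @ultraFilterLemma nat \oo _.
have properU : ProperFilter U by exact: ultra_proper.
pose B := [set n | U [set i | good (a i) n]].
exists B; last first.
  move=> b b' Bb Bb'.
  have [i [[a1 _] [_ a2]]] := filter_ex (filterI Bb Bb').
  exists (a i + P b) => //; exists (a i - Q b') => //.
  by rewrite opprB addrC addrA subrK addrC.
rewrite /upper_density; apply: (limn_esup_gt0 c2) => j.
(* One of the finitely many [k] in the window of [j] works for almost all [i], and
   on the finite set [F k] the set [B] agrees with the set of the good points for
   [a i], for almost all [i]. *)
have [k /andP[jk kM] Uk] : exists2 k, (j <= k < M j)%N & U [set i | E k (a i)].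
  apply: contrapT => nU.
  have : U [set i | {in index_iota j (M j), forall k, ~ E k (a i)}].
    apply: filter_in_seq => k; rewrite mem_index_iota => jkM.
    have [Uk|//] := in_ultra_setVsetC [set i | E k (a i)] ultraU.
    by case: nU; exists k.
  have : U [set i | (j <= i)%N] by apply: ooU; exact: nbhs_infty_ge.
  move=> U1 U2; have [i [ji nE]] := filter_ex (filterI U1 U2).
  have [k jkM Ek] := aP i j ji.
  by apply: (nE k _ Ek); rewrite mem_index_iota.
exists k => //; rewrite density_avgE.
have UF : U [set i | {in F k, forall n, \1_B n = ind (a i) n}].
  apply: filter_in_seq => n _.
  have [Ug|Ung] := in_ultra_setVsetC [set i | good (a i) n] ultraU.
    have nB : n \in B by apply/mem_set.
    by apply: filterS Ug => i gi; rewrite indE !indicE nB mem_set.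
  apply: filterS (Ung) => i ngi; rewrite indE !indicE !memNset // => Bn.
  by have [i' [gi' []]] := filter_ex (filterI Bn Ung).
have [i [Eai iF]] := filter_ex (filterI Uk UF).
apply: le_trans Eai _; rewrite le_eqVlt; apply/orP; left; apply/eqP.
rewrite /dens /avg; congr (_ *: _).
by rewrite big_seq [RHS]big_seq; apply: eq_bigr => n /iF.
Qed.

End PatternDensity.
(** * Sums of polynomial maps in difference sets *)

Lemma layered_sum_of_polynomial_maps (d e s : nat)
    (p q : 'I_s -> 'rV[int]_d -> 'rV[int]_e) :
  (forall i, polynomial_map (p i) /\ p i 0 = 0) ->
  (forall i, polynomial_map (q i) /\ q i 0 = 0) ->
  exists2 K, (0 < K)%N & layered_polynomial (fun n : 'rV[int]_d =>
    (\matrix_(i, j) p i (n *+ K) 0 j : 'M[int]_(s, e))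
    + \matrix_(i, j) q i (n *+ K) 0 j).
Proof.
move=> hp hq.
have [P PE] := choice (fun i => (hp i).1).
have [Q QE] := choice (fun i => (hq i).1).
apply: (@layered_integer_polynomial _ _ _ (fun n : 'rV[int]_d =>
    (\matrix_(i, j) p i n 0 j : 'M[int]_(s, e)) + \matrix_(i, j) q i n 0 j)
    (fun i j => P i j + Q i j)).
  by move=> n i j; rewrite !mxE intrD PE QE mpoly.mevalD.
by apply/matrixP => i j; rewrite !mxE (hp i).2 (hq i).2 !mxE addr0.
Qed.

Unset Implicit Arguments.

Theorem theorem1p42 (R : realType) (d e s : nat)
    (p q : 'I_s -> 'rV[int]_d -> 'rV[int]_e)
    (hp : forall i : 'I_s, polynomial_map (p i) /\ p i 0 = 0)
    (hq : forall i : 'I_s, polynomial_map (q i) /\ q i 0 = 0)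
    (A : set 'rV[int]_e)
    (hA : (0 < upper_banach_density R A)%E)
    (F : nat -> {fset 'rV[int]_d})
    (hF : folner R F) :
  exists B : set 'rV[int]_d,
    (0 < upper_density R F B)%E /\
    \bigcup_(i in [set: 'I_s]) sumset (p i @` B) (q i @` B) `<=` diffset A A.
Proof.
have [_ [Phi folnerPhi <-] Phi_pos] := ereal_sup_gt hA.
have [delta delta0 freq] := limn_esup_gt0_freq Phi_pos.
have size_Phi N := folner_size_gt0 N folnerPhi.
have [Psi [invPsi Psi0 indE]] := asymptotically_invariant_power s A
  (folner_invariant folnerPhi) size_Phi.
pose A' := [set a : 'M[int]_(s, e) | forall i, A (row i a)].
have [|m meanA'] := exists_invariant_mean (delta := delta ^+ s) invPsi Psi0
    (@bounded_indic R _ A').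
  move=> N0; have [N leN dN] := freq N0; exists N => //.
  rewrite indE -density_avgE; apply: lerXn2r (dN); rewrite nnegrE ltW //.
  exact: lt_le_trans dN.
have [K K0 pqK] := layered_sum_of_polynomial_maps hp hq.
have A'0 : 0 < mean m \1_A' by apply: lt_le_trans meanA'; rewrite exprn_gt0.
have [B B0 pattern] := pattern_density
  (P := fun n => \matrix_(i, j) p i n 0 j) (Q := fun n => \matrix_(i, j) q i n 0 j)
  K0 pqK A'0 hF.
exists B; split=> // _ [i _ [_ [b Bb <-] [_ [b' Bb' <-] <-]]].
have [a Aa [a' Aa' E]] := pattern b b' Bb Bb'.
exists (row i a) => //; exists (row i a') => //.
by apply/rowP => j; have /matrixP/(_ i j) := E; rewrite !mxE.
Qed.
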